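(* Consider the following problem, with the number $m$ of machines a fixed constant. An instance consists of $n$ jobs $J_1,\ldots,J_n$, where job $J_j$ has a processing time $p_j\ge 0$ and a rejection penalty $e_j\ge 0$, $m$ identical machines $M_1,\ldots,M_m$, and a bound $U\ge 0$. A feasible solution partitions the jobs into an accepted set $A$ and a rejected set $R$ with $\sum_{J_j\in A}p_j\le U$, and assigns every accepted job to one machine. The load of a machine is the total processing time of the jobs assigned to it, the makespan $C_{\max}(A)$ is the maximum load, and the cost is $C_{\max}(A)+\sum_{J_j\in R}e_j$, to be minimized. Then this problem admits an efficient polynomial-time approximation scheme (EPTAS): for every $\epsilon\in(0,1)$ with $1/\epsilon$ an integer, there is an algorithm that on every instance returns a feasible solution of cost at most $(1+\epsilon)$ times the optimal cost, in running time $f(1/\epsilon)\cdot n^{O(1)}$ for some computable function $f$ (which may depend on the fixed constant $m$).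
   Context: This problem is denoted $Pm\mid rej, U, r_i=r\mid C_{\max}(A)+\sum_{J_j\in R}e_j$; it arises from a machine-cost constraint $r\sum_i t_i\le\hat U$ with uniform energy cost rate $r$, rewritten with $U=\hat U/r$ as a bound on the total processing time of accepted jobs. *)

(* Defs.v *)
From HB Require Import structures.
From mathcomp Require Import all_boot all_order all_algebra.
Set Implicit Arguments.
Unset Strict Implicit.
Unset Printing Implicit Defensive.
Import Order.TTheory GRing.Theory Num.Theory.
Local Open Scope ring_scope.

(** * The scheduling problem *)

Record instance (R : realFieldType) (n : nat) := Instance {
  ptime : 'I_n -> R;
  penalty : 'I_n -> R;
  bound : R;
  ptime_ge0 : forall j, 0 <= ptime j;
  penalty_ge0 : forall j, 0 <= penalty j;
  bound_ge0 : 0 <= bound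
}.

(* [sol j = Some i]: job j is accepted and runs on machine i;
   [sol j = None]: job j is rejected. *)
Definition solution (n m : nat) := {ffun 'I_n -> option 'I_m}.

Section Problem.
Variables (R : realFieldType) (n m : nat) (I : instance R n).
Implicit Type sol : solution n m.

Definition accepted sol : {set 'I_n} := [set j | sol j != None].
Definition rejected sol : {set 'I_n} := [set j | sol j == None].

Definition feasible sol : bool :=
  \sum_(j in accepted sol) ptime I j <= bound I.

Definition load sol (i : 'I_m) : R := \sum_(j | sol j == Some i) ptime I j.

(* The default value 0 is harmless: loads are nonnegative. *)
Definition makespan sol : R := \big[Num.max/0]_(i < m) load sol i.

Definition cost sol : R := makespan sol + \sum_(j in rejected sol) penalty I j.

Definition reject_all : solution n m := [ffun => None].

(* The minimum of [cost] over the feasible solutions; rejecting every job is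
   feasible, so there is one. *)
Definition opt_cost : R :=
  cost [arg min_(sol < reject_all | feasible sol) cost sol]%O.

Lemma feasible_reject_all : feasible reject_all.
Proof.
by rewrite /feasible big1 ?bound_ge0 // => j; rewrite inE ffunE eqxx.
Qed.

Lemma opt_costP :
  (exists2 sol, feasible sol & opt_cost = cost sol) /\
  (forall sol, feasible sol -> opt_cost <= cost sol).
Proof.
rewrite /opt_cost; case: (arg_minP cost feasible_reject_all) => s fs smin.
by split; [exists s | exact: smin].
Qed.

End Problem.

(** * The machine model *)

(* A unit-cost random access machine with structured control flow.  It has two
   sorts of memory, one for natural numbers (counting and addressing) and one
   for the numbers of the instance; each consists of registers and of unbounded
   arrays.  The only arithmetic operations are addition and subtraction, and
   there is no rounding from the second sort to the first.  So on rational data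
   every number stored after t steps is an integer combination, with
   coefficients of O(t) bits, of the input numbers and 1, and unit cost is
   polynomially related to bit cost.  A program contains no constants from the
   ordered field it is run over, other than natural numbers. *)

Inductive instr :=
  | IConst (x v : nat)
  | IMove (x y : nat)
  | IAdd (x y z : nat)
  | ISub (x y z : nat)
  | ILoad (x a y : nat)    (* x := a[y] *)
  | IStore (a y x : nat)   (* a[y] := x *)
  | VConst (x v : nat)
  | VMove (x y : nat)
  | VAdd (x y z : nat)
  | VSub (x y z : nat)
  | VLoad (x a y : nat)    (* y is a natural number register *)
  | VStore (a y x : nat).  (* y is a natural number register *)

Inductive test :=
  | ILe of nat & nat
  | ILt of nat & nat
  | VLe of nat & nat
  | VLt of nat & nat.

Inductive program :=
  | Skip
  | Instr of instr
  | Seq of program & program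
  | If of test & program & program
  | While of test & program.

Record state (R : Type) := State {
  ireg : nat -> nat;
  iarr : nat -> nat -> nat;
  vreg : nat -> R;
  varr : nat -> nat -> R
}.

Definition upd (T : Type) (g : nat -> T) (x : nat) (v : T) : nat -> T :=
  fun y => if y == x then v else g y.

Section Semantics.
Variable R : realFieldType.
Implicit Type s : state R.

Definition set_ireg s x v := State (upd (ireg s) x v) (iarr s) (vreg s) (varr s).
Definition set_iarr s a i v :=
  State (ireg s) (upd (iarr s) a (upd (iarr s a) i v)) (vreg s) (varr s).
Definition set_vreg s x v := State (ireg s) (iarr s) (upd (vreg s) x v) (varr s).
Definition set_varr s a i v :=
  State (ireg s) (iarr s) (vreg s) (upd (varr s) a (upd (varr s a) i v)).

Definition exec_instr (c : instr) s : state R :=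
  match c with
  | IConst x v => set_ireg s x v
  | IMove x y => set_ireg s x (ireg s y)
  | IAdd x y z => set_ireg s x (ireg s y + ireg s z)%N
  | ISub x y z => set_ireg s x (ireg s y - ireg s z)%N
  | ILoad x a y => set_ireg s x (iarr s a (ireg s y))
  | IStore a y x => set_iarr s a (ireg s y) (ireg s x)
  | VConst x v => set_vreg s x v%:R
  | VMove x y => set_vreg s x (vreg s y)
  | VAdd x y z => set_vreg s x (vreg s y + vreg s z)
  | VSub x y z => set_vreg s x (vreg s y - vreg s z)
  | VLoad x a y => set_vreg s x (varr s a (ireg s y))
  | VStore a y x => set_varr s a (ireg s y) (vreg s x)
  end.

Definition eval_test (b : test) s : bool :=
  match b with
  | ILe x y => (ireg s x <= ireg s y)%N
  | ILt x y => (ireg s x < ireg s y)%N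
  | VLe x y => vreg s x <= vreg s y
  | VLt x y => vreg s x < vreg s y
  end.

(* [exec c s t s']: started in state s, program c halts in state s' after
   exactly t steps; every instruction and every test is one step. *)
Inductive exec : program -> state R -> nat -> state R -> Prop :=
  | ExecSkip s : exec Skip s 1 s
  | ExecInstr c s : exec (Instr c) s 1 (exec_instr c s)
  | ExecSeq c1 c2 s1 s2 s3 t1 t2 :
      exec c1 s1 t1 s2 -> exec c2 s2 t2 s3 -> exec (Seq c1 c2) s1 (t1 + t2) s3
  | ExecIfTrue b c1 c2 s s' t :
      eval_test b s -> exec c1 s t s' -> exec (If b c1 c2) s t.+1 s'
  | ExecIfFalse b c1 c2 s s' t :
      ~~ eval_test b s -> exec c2 s t s' -> exec (If b c1 c2) s t.+1 s'
  | ExecWhileTrue b c s1 s2 s3 t1 t2 :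
      eval_test b s1 -> exec c s1 t1 s2 -> exec (While b c) s2 t2 s3 ->
      exec (While b c) s1 (t1 + t2).+1 s3
  | ExecWhileFalse b c s :
      ~~ eval_test b s -> exec (While b c) s 1 s.

Lemma exec_det c s t s' :
  exec c s t s' -> forall u s'', exec c s u s'' -> t = u /\ s' = s''.
Proof.
elim=> {c s t s'}.
- by move=> s u s'' E; inversion E.
- by move=> c s u s'' E; inversion E.
- move=> c1 c2 s1 s2 s3 t1 t2 _ IH1 _ IH2 u s'' E.
  inversion E as [| |? ? ? ? ? ? ? E1 E2| | | |]; subst.
  by have [-> e] := IH1 _ _ E1; subst; have [-> ->] := IH2 _ _ E2.
- move=> b c1 c2 s s' t bT _ IH u s'' E.
  inversion E as [| | |? ? ? ? ? ? bv E1|? ? ? ? ? ? bv E1| |]; subst.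
    by have [-> ->] := IH _ _ E1.
  by rewrite bT in bv.
- move=> b c1 c2 s s' t bF _ IH u s'' E.
  inversion E as [| | |? ? ? ? ? ? bv E1|? ? ? ? ? ? bv E1| |]; subst.
    by rewrite bv in bF.
  by have [-> ->] := IH _ _ E1.
- move=> b c s1 s2 s3 t1 t2 bT _ IH1 _ IH2 u s'' E.
  inversion E as [| | | | |? ? ? ? ? ? ? bv E1 E2|? ? ? bv]; subst.
    by have [-> e] := IH1 _ _ E1; subst; have [-> ->] := IH2 _ _ E2.
  by rewrite bT in bv.
- move=> b c s bF u s'' E.
  inversion E as [| | | | |? ? ? ? ? ? ? bv E1 E2|? ? ? bv]; subst => //.
  by rewrite bv in bF.
Qed.

(* The number of jobs and the bound U are in register 0 of their sort, the
   processing times in array 0 and the penalties in array 1; all other cells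
   contain 0. *)
Definition init_state (n : nat) (I : instance R n) : state R :=
  let vec (g : 'I_n -> R) (j : nat) := oapp g 0 (insub j) in
  State (upd (fun=> 0%N) 0 n) (fun=> fun=> 0%N)
        (upd (fun=> 0) 0 (bound I))
        (upd (upd (fun=> fun=> 0) 0 (vec (ptime I))) 1 (vec (penalty I))).

(* Cell j of array 0 of natural numbers contains 0 if job j is rejected, and
   i + 1 if it is assigned to machine i. *)
Definition outputs (n m : nat) s (sol : solution n m) : Prop :=
  forall j : 'I_n, iarr s 0 j = oapp (fun i : 'I_m => i.+1) 0%N (sol j).

End Semantics.

(* Computability in the same machine model; the number memory, here over the
   rationals, initially contains only 0. *)
Definition computable (f : nat -> nat) : Prop :=
  exists c : program, forall k : nat, exists (t : nat) (s : state rat),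
    exec c (State (upd (fun=> 0%N) 0 k) (fun=> fun=> 0%N)
                  (fun=> 0) (fun=> fun=> 0)) t s
    /\ ireg s 0 = f k.

(* Main.v *)
(** An FPTAS whose exponent in n depends on m.  Let v be the largest number that
    contributes to the optimal cost (the time of an accepted job or the penalty
    of a rejected one); then v <= OPT, and v is one of the input numbers, so
    every candidate is tried.  Measure values in units of v / (n k), rounded up.
    Each option (rejection, or one of the machines) then has an integral load of
    at most n (n k), and the m + 1 loads are the digits of a code in base
    n (n k) + 1.  A dynamic program over jobs and codes finds, for each code,
    the choice of least exact accepted processing time, so the bound U is never
    rounded.  A choice with the code of an optimal solution and no larger
    accepted time is feasible, and costs at most v / k more than the optimum,
    since every job contributes a rounding error of at most v / (n k). *)

Require Import Defs.
From HB Require Import structures.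
From mathcomp Require Import all_boot all_order all_algebra.
From mathcomp Require Import zify ring lra.
Set Implicit Arguments.
Unset Strict Implicit.
Unset Printing Implicit Defensive.
Import Order.TTheory GRing.Theory Num.Theory.
Local Open Scope ring_scope.

(** * Commands with bounded loops *)

(** Counted loops are the only loops, so termination is automatic and running times can be bounded
    by structural recursion. *)
Inductive cmd :=
  | Nop
  | Do of instr
  | Then of cmd & cmd
  | Cond of test & cmd & cmd
  | For of nat & nat & cmd.

(** Register 1 for natural numbers is reserved for the number 1: a loop counter is advanced by
    adding that register, since no instruction adds a constant. *)
Fixpoint compile (c : cmd) : program :=
  match c with
  | Nop => Skip
  | Do i => Instr i
  | Then c1 c2 => Seq (compile c1) (compile c2)
  | Cond b c1 c2 => If b (compile c1) (compile c2)
  | For x y b =>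
      Seq (Instr (IConst x 0))
          (While (ILt x y) (Seq (compile b) (Instr (IAdd x x 1))))
  end.

(* Sorts of cells: 0 for natural number registers, 1 for natural number arrays
   (as a whole), 2 and 3 likewise for the numbers of the instance. *)
Definition target (i : instr) : nat * nat :=
  match i with
  | IConst x _ | IMove x _ | IAdd x _ _ | ISub x _ _ | ILoad x _ _ => (0, x)
  | IStore a _ _ => (1, a)
  | VConst x _ | VMove x _ | VAdd x _ _ | VSub x _ _ | VLoad x _ _ => (2, x)
  | VStore a _ _ => (3, a)
  end%N.

Fixpoint writes (c : cmd) : seq (nat * nat) :=
  match c with
  | Nop => [::]
  | Do i => [:: target i]
  | Then c1 c2 | Cond _ c1 c2 => writes c1 ++ writes c2
  | For x _ b => (0%N, x) :: writes b
  end.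

Fixpoint loop_bounds (c : cmd) : seq (nat * nat) :=
  match c with
  | Nop | Do _ => [::]
  | Then c1 c2 | Cond _ c1 c2 => loop_bounds c1 ++ loop_bounds c2
  | For _ y b => (0%N, y) :: loop_bounds b
  end.

(** These conditions keep register 1 intact and make the number of iterations of a loop the value of
    its bound on entry. *)
Fixpoint well_formed (c : cmd) : bool :=
  match c with
  | Nop => true
  | Do i => target i != (0, 1)%N
  | Then c1 c2 | Cond _ c1 c2 => well_formed c1 && well_formed c2
  | For x y b =>
      [&& x != 1%N, y != x, (0%N, x) \notin writes b, (0%N, y) \notin writes b
        & well_formed b]
  end.

(** The running time is bounded by the weight times [L] to the nesting depth, where [L] bounds all
    loop counts. The 4 pays for a test and an increment in each iteration and, once, for the
    initialization and the failing test. *)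
Fixpoint weight (c : cmd) : nat :=
  match c with
  | Nop | Do _ => 1
  | Then c1 c2 | Cond _ c1 c2 => (weight c1 + weight c2).+1
  | For _ _ b => (weight b + 4)
  end.

Fixpoint depth (c : cmd) : nat :=
  match c with
  | Nop | Do _ => 0
  | Then c1 c2 | Cond _ c1 c2 => maxn (depth c1) (depth c2)
  | For _ _ b => (depth b).+1
  end.

(** * Semantics, frame property and running time of commands *)

Section Run.
Variable R : realFieldType.
Implicit Types (s : state R) (c : cmd).

Fixpoint run c s : state R :=
  match c with
  | Nop => s
  | Do i => exec_instr i s
  | Then c1 c2 => run c2 (run c1 s)
  | Cond b c1 c2 => if eval_test b s then run c1 s else run c2 s
  | For x y b =>
      iteri (ireg s y) (fun i s' => set_ireg (run b s') x i.+1) (set_ireg s x 0)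
  end.

Definition agree (ws : seq (nat * nat)) s s' : Prop :=
  [/\ forall x, (0%N, x) \notin ws -> ireg s' x = ireg s x,
      forall a, (1%N, a) \notin ws -> iarr s' a = iarr s a,
      forall x, (2%N, x) \notin ws -> vreg s' x = vreg s x
    & forall a, (3%N, a) \notin ws -> varr s' a = varr s a].

Lemma agree_refl ws s : agree ws s s.
Proof. by split. Qed.

Lemma agree_trans ws s1 s2 s3 :
  agree ws s1 s2 -> agree ws s2 s3 -> agree ws s1 s3.
Proof.
case=> [a1 a2 a3 a4] [b1 b2 b3 b4].
by split=> x xW; rewrite ?b1 ?b2 ?b3 ?b4 // ?a1 ?a2 ?a3 ?a4.
Qed.

Lemma agree_sub ws ws' s s' :
  {subset ws <= ws'} -> agree ws s s' -> agree ws' s s'.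
Proof.
move=> sub [a1 a2 a3 a4].
have sub' x : x \notin ws' -> x \notin ws by apply: contraNN; apply: sub.
by split=> x /sub' xW; [apply: a1 | apply: a2 | apply: a3 | apply: a4].
Qed.

Lemma upd_neq (T : Type) (g : nat -> T) x v y : y != x -> upd g x v y = g y.
Proof. by rewrite /upd => /negPf->. Qed.

Lemma upd_eq (T : Type) (g : nat -> T) x v : upd g x v x = v.
Proof. by rewrite /upd eqxx. Qed.

Lemma exec_instr_agree i s : agree [:: target i] s (exec_instr i s).
Proof.
by case: i => *; split=> // z; rewrite inE xpair_eqE /= => zP; rewrite upd_neq.
Qed.

Lemma set_ireg_agree x v s : agree [:: (0%N, x)] s (set_ireg s x v).
Proof. exact: (exec_instr_agree (IConst x v)). Qed.

Lemma run_agree c s : agree (writes c) s (run c s).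
Proof.
elim: c s => [|i|c1 IH1 c2 IH2|b c1 IH1 c2 IH2|x y b IH] s /=.
- exact: agree_refl.
- exact: exec_instr_agree.
- apply: (@agree_trans _ _ (run c1 s)).
    by apply: agree_sub (IH1 s) => z; rewrite mem_cat => ->.
  by apply: agree_sub (IH2 _) => z; rewrite mem_cat => ->; rewrite orbT.
- case: ifP => _.
    by apply: agree_sub (IH1 s) => z; rewrite mem_cat => ->.
  by apply: agree_sub (IH2 _) => z; rewrite mem_cat => ->; rewrite orbT.
- have sx s' v : agree ((0%N, x) :: writes b) s' (set_ireg s' x v).
    by apply: agree_sub (set_ireg_agree x v s') => z; rewrite !inE => ->.
  elim: (ireg s y) => [|N IHN] /=; first exact: sx.
  apply: agree_trans IHN _; apply: agree_trans (sx _ _).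
  by apply: agree_sub (IH _) => z; rewrite inE => ->; rewrite orbT.
Qed.

Lemma run_ireg c s x : (0%N, x) \notin writes c -> ireg (run c s) x = ireg s x.
Proof. by case: (run_agree c s) => ag _ _ _; apply: ag. Qed.

(** The step may use agreement with the state before the loop, so an invariant [P] only has to
    mention what the loop changes. *)
Lemma for_ind (P : nat -> state R -> Prop) x y b s :
  (0%N, x) \notin writes b ->
  P 0%N (set_ireg s x 0) ->
  (forall i s', (i < ireg s y)%N -> agree ((0%N, x) :: writes b) s s' ->
     ireg s' x = i -> P i s' -> P i.+1 (set_ireg (run b s') x i.+1)) ->
  P (ireg s y) (run (For x y b) s).
Proof.
move=> xb P0 PS /=.
suff: forall N, (N <= ireg s y)%N ->
   let s' := iteri N (fun i s' => set_ireg (run b s') x i.+1) (set_ireg s x 0) in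
   [/\ agree ((0%N, x) :: writes b) s s', ireg s' x = N & P N s'].
  by case/(_ _ (leqnn _)).
have sx s' v : agree ((0%N, x) :: writes b) s' (set_ireg s' x v).
  by apply: agree_sub (set_ireg_agree x v s') => z; rewrite !inE => ->.
elim=> [|N IHN] ltN /=; first by split=> //; rewrite ?upd_eq.
have [ag eN PN] := IHN (ltnW ltN); split; last exact: PS; last by rewrite upd_eq.
apply: agree_trans ag _; apply: agree_trans (sx _ _).
by apply: agree_sub (run_agree _ _) => z; rewrite inE => ->; rewrite orbT.
Qed.

Lemma well_formed_one c : well_formed c -> (0, 1)%N \notin writes c.
Proof.
elim: c => //= [i|c1 IH1 c2 IH2|_ c1 IH1 c2 IH2|x y b IH].
- by rewrite inE eq_sym.
- by rewrite mem_cat negb_or => /andP[/IH1-> /IH2->].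
- by rewrite mem_cat negb_or => /andP[/IH1-> /IH2->].
- by case/and5P=> x1 _ _ _ /IH; rewrite inE negb_or xpair_eqE /= eq_sym x1.
Qed.

(* The loop bounds are registers that the command itself does not write, so the
   running time is bounded from the initial state alone. *)
Lemma exec_run (L : nat) c s :
  well_formed c -> (0 < L)%N -> ireg s 1 = 1%N ->
  all (fun y => y \notin writes c) (loop_bounds c) ->
  (forall y, (0%N, y) \in loop_bounds c -> (ireg s y <= L)%N) ->
  exists2 t, exec (compile c) s t (run c s) & (t <= weight c * L ^ depth c)%N.
Proof.
move=> wf L0 s1 /allP; elim: c s s1 wf => [|i|c1 IH1 c2 IH2|b c1 IH1 c2 IH2|x y b IH] s s1.
- by exists 1%N; [exact: ExecSkip | rewrite muln1].
- by exists 1%N; [exact: ExecInstr | rewrite muln1].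
- move=> /= /andP[wf1 wf2] dis le.
  have [||t1 e1 l1] := IH1 s s1 wf1.
  + move=> z zl; have := dis z; rewrite !mem_cat zl => /(_ isT).
    by rewrite negb_or => /andP[].
  + by move=> z zl; apply: le; rewrite mem_cat zl.
  have [|||t2 e2 l2] := IH2 (run c1 s) _ wf2.
  + by rewrite run_ireg ?well_formed_one.
  + move=> z zl; have := dis z; rewrite !mem_cat zl orbT => /(_ isT).
    by rewrite negb_or => /andP[].
  + move=> z zl; have := dis (0%N, z); rewrite !mem_cat zl orbT => /(_ isT).
    rewrite negb_or => /andP[z1 _]; rewrite run_ireg //.
    by apply: le; rewrite mem_cat zl orbT.
  exists (t1 + t2)%N; first exact: ExecSeq e1 e2.
  rewrite mulSn mulnDl; apply: leq_trans (leq_addl _ _).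
  apply: leq_add; [apply: leq_trans l1 _ | apply: leq_trans l2 _];
    by rewrite leq_mul2l leq_pexp2l ?orbT // ?leq_maxl ?leq_maxr.
- move=> /= /andP[wf1 wf2] dis le.
  have [||t1 e1 l1] := IH1 s s1 wf1.
  + move=> z zl; have := dis z; rewrite !mem_cat zl => /(_ isT).
    by rewrite negb_or => /andP[].
  + by move=> z zl; apply: le; rewrite mem_cat zl.
  have [||t2 e2 l2] := IH2 s s1 wf2.
  + move=> z zl; have := dis z; rewrite !mem_cat zl orbT => /(_ isT).
    by rewrite negb_or => /andP[].
  + by move=> z zl; apply: le; rewrite mem_cat zl orbT.
  have D1 : (L ^ depth c1 <= L ^ maxn (depth c1) (depth c2))%N.
    by rewrite leq_pexp2l ?leq_maxl.
  have D2 : (L ^ depth c2 <= L ^ maxn (depth c1) (depth c2))%N.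
    by rewrite leq_pexp2l ?leq_maxr.
  have D0 : (0 < L ^ maxn (depth c1) (depth c2))%N by rewrite expn_gt0 L0.
  case: ifPn => bs.
    by exists t1.+1; [exact: ExecIfTrue | nia].
  by exists t2.+1; [exact: ExecIfFalse | nia].
- move=> /= /and5P[x1 yx xb yb wfb] dis le.
  have sx s' v : agree ((0%N, x) :: writes b) s' (set_ireg s' x v).
    by apply: agree_sub (set_ireg_agree x v s') => z; rewrite !inE => ->.
  pose S i := iteri i (fun i s' => set_ireg (run b s') x i.+1) (set_ireg s x 0).
  have Sag i : agree ((0%N, x) :: writes b) s (S i).
    elim: i => [|i IHi] /=; first exact: sx.
    apply: agree_trans IHi _; apply: agree_trans (sx _ _).
    by apply: agree_sub (run_agree _ _) => z; rewrite inE => ->; rewrite orbT.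
  have Sx i : ireg (S i) x = i by case: i => [|i] /=; rewrite upd_eq.
  have Sy i : ireg (S i) y = ireg s y.
    case: (Sag i) => ag _ _ _; apply: ag.
    by rewrite inE negb_or xpair_eqE /= yx.
  have S1 i : ireg (S i) 1 = 1%N.
    case: (Sag i) => ag _ _ _; rewrite ag //.
    by rewrite inE negb_or xpair_eqE /= eq_sym x1 well_formed_one.
  pose tb := (weight b * L ^ depth b)%N.
  have body i : exists2 t, exec (compile b) (S i) t (run b (S i)) & (t <= tb)%N.
    apply: IH => //.
      move=> z zl; have := dis z; rewrite !inE zl orbT => /(_ isT).
      by rewrite negb_or => /andP[].
    move=> z zl; have := dis (0%N, z); rewrite !inE zl orbT => /(_ isT) zP.
    case: (Sag i) => ag _ _ _; rewrite ag //.
    by apply: le; rewrite inE zl orbT.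
  have loop d i : (d + i = ireg s y)%N -> exists2 t,
      exec (While (ILt x y) (Seq (compile b) (Instr (IAdd x x 1))))
        (S i) t (S (ireg s y)) & (t <= d * (tb + 2) + 1)%N.
    elim: d i => [|d IHd] i.
      rewrite add0n => ->; exists 1%N => //; apply: ExecWhileFalse.
      by rewrite /= Sx Sy ltnn.
    rewrite addSnnS => di; have [t2 e2 l2] := IHd _ di.
    have [t1 e1 l1] := body i; exists (t1 + 1 + t2).+1; last by lia.
    apply: ExecWhileTrue e2; first by rewrite /= Sx Sy -di; lia.
    apply: ExecSeq e1 _.
    suff -> : S i.+1 = exec_instr (IAdd x x 1) (run b (S i)) by apply: ExecInstr.
    by rewrite /= !run_ireg ?well_formed_one // Sx S1 addn1.
  have [t e l] := loop (ireg s y) 0%N (addn0 _).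
  exists (1 + t)%N; first by apply: ExecSeq e; apply: ExecInstr.
  have sL : (ireg s y <= L)%N by apply: le; rewrite inE eqxx.
  have L1 : (0 < L ^ depth b)%N by rewrite expn_gt0 L0.
  rewrite expnS; rewrite /tb in l.
  have : (ireg s y * (weight b * L ^ depth b + 2) <=
          L * (weight b * L ^ depth b + 2))%N by rewrite leq_mul2r sL orbT.
  have : (L <= L * L ^ depth b)%N by rewrite leq_pmulr.
  nia.
Qed.

End Run.

(** * Rounding, codes and the table *)

Lemma digits_lt (B M : nat) (a : nat -> nat) :
  (forall o, a o < B)%N -> (\sum_(o < M) a o * B ^ o < B ^ M)%N.
Proof.
move=> aB; elim: M => [|M IH]; first by rewrite big_ord0.
rewrite big_ord_recr /= expnS; have := aB M.
by move: IH; set x := (\sum_(o < M) _)%N; set y := (B ^ M)%N; nia.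
Qed.

(** By [digits_lt] the lower digits sum to less than [B ^ M], so dividing by [B ^ M] isolates the
    top digit; the remaining digits follow by induction. *)
Lemma digits_inj (B M : nat) (a b : nat -> nat) :
  (forall o, a o < B)%N -> (forall o, b o < B)%N ->
  (\sum_(o < M) a o * B ^ o = \sum_(o < M) b o * B ^ o)%N ->
  forall o, (o < M)%N -> a o = b o.
Proof.
elim: M => [|M IH] // aB bB.
rewrite !big_ord_recr /= => E.
have := digits_lt M aB; have := digits_lt M bB; move: E IH.
set x := (\sum_(o < M) _)%N; set y := (\sum_(o < M) _)%N; set z := (B ^ M)%N.
move=> E IH ly lx.
have EM : a M = b M.
  have z0 : (0 < z)%N by apply: leq_trans ly.
  by have := congr1 (divn^~ z) E; rewrite !(addnC _ (_ * z)%N) !divnMDl ?divn_small ?addn0.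
move=> o; rewrite ltnS leq_eqVlt => /orP[/eqP->//|]; apply: IH => //.
by apply: (@addIn (a M * z)); rewrite E EM.
Qed.

Lemma sum_by_choice (V : nmodType) (n M : nat) (F : nat -> nat -> V)
    (c : nat -> nat) :
  (forall j, j < n -> c j < M)%N ->
  \sum_(j < n) F j (c j) = \sum_(o < M) \sum_(j < n | c j == o) F j o.
Proof.
move=> cM; under [RHS]eq_bigr do rewrite big_mkcond.
rewrite exchange_big /=; apply: eq_bigr => j _.
rewrite -big_mkcond (big_pred1 (Ordinal (cM j (ltn_ord j)))) //.
Qed.

(** * Rounding up by repeated subtraction *)

Section Rounding.
Variable R : realFieldType.

(** The machine cannot divide, so the quotient is found by counting subtractions. Subtracting
    whenever the remainder is positive, and so possibly below zero, makes this a rounding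
    upwards. *)
Definition round_step (v : R) (r : R * nat) : R * nat :=
  if 0 < r.1 then (r.1 - v, r.2.+1) else r.

(* The second component is [min N (ceil (x / v))]; for [v = 0] it is 0 or [N]
   according to whether [x] is 0. *)
Definition round_up (v x : R) (N : nat) : R * nat :=
  iter N (round_step v) (x, 0%N).

(** The last bound holds because each subtraction starts from a positive remainder, so the multiple
    of [v] overshoots [x] by at most [v]. *)
Lemma round_upP (v x : R) (N : nat) : 0 <= v -> 0 <= x ->
  let r := round_up v x N in
  [/\ r.1 = x - r.2%:R * v, (r.2 <= N)%N, 0 < r.1 -> r.2 = N
    & r.2%:R * v <= x + v].
Proof.
move=> v0 x0; elim: N => [|N [E le full up]] /=.
  by rewrite mul0r subr0; split=> //; apply: addr_ge0.
move: E le full up; rewrite /round_up; set r := iter N _ _ => E le full up.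
rewrite /round_step; case: ifPn => r0 /=; last first.
  by split=> //; [exact: leqW | rewrite (negPf r0)].
rewrite -natr1; split=> //; first by rewrite E; ring.
- by move=> _; rewrite full.
- by move: r0; rewrite E; lra.
Qed.

End Rounding.

(** * Codes of choices, rounding errors and the dynamic program *)

Section Selection.
Variables (R : realFieldType) (n m k : nat) (P E : nat -> R).
Hypotheses (P_ge0 : forall j, 0 <= P j) (E_ge0 : forall j, 0 <= E j).
Implicit Types (v : R) (c : nat -> nat).

(* A choice [c] of an option for every job: 0 for rejection, and [i + 1] for
   machine [i]. *)
Definition value (j o : nat) : R := if o == 0%N then E j else P j.
Definition time_of (j o : nat) : R := if o == 0%N then 0 else P j.
Definition option_load c (o : nat) : R := \sum_(j < n | c j == o) value j o.
Definition choice_cost c : R :=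
  \big[Num.max/0]_(i < m) option_load c i.+1 + option_load c 0.

(** A value at most [v] rounds up to at most [cap] units of [v / cap], so a sum of at most [n] of
    them is a digit in base [base]. *)
Definition cap := (n * k)%N.
Definition base := (n * cap).+1.
Definition ncodes := (base ^ m.+1)%N.

Definition rounded v j o := round_up v (value j o *+ cap) cap.

(* An option of value larger than [v] gets the unusable weight [ncodes]. *)
Definition code_weight v j o : nat :=
  if 0 < (rounded v j o).1 then ncodes else ((rounded v j o).2 * base ^ o)%N.

Definition digit v c o := (\sum_(j < n | c j == o) (rounded v j o).2)%N.

Lemma value_ge0 j o : 0 <= value j o.
Proof. by rewrite /value; case: ifP. Qed.

Lemma time_of_ge0 j o : 0 <= time_of j o.
Proof. by rewrite /time_of; case: ifP. Qed.

Lemma option_load_ge0 c o : 0 <= option_load c o.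
Proof. by apply: sumr_ge0 => j _; apply: value_ge0. Qed.

Lemma eq_choice_cost c c' :
  (forall j, (j < n)%N -> c j = c' j) -> choice_cost c = choice_cost c'.
Proof.
move=> cc'.
have el o : option_load c o = option_load c' o.
  by apply: eq_bigl => j; rewrite cc'.
by rewrite /choice_cost el; congr (_ + _); apply: eq_bigr => i _.
Qed.

Lemma option_load_le_cost c o : (o <= m)%N -> option_load c o <= choice_cost c.
Proof.
case: o => [|i] im.
  by rewrite lerDr; apply: bigmax_ge_id.
rewrite -[leLHS]addr0; apply: lerD (option_load_ge0 _ _).
exact: (le_bigmax _ (fun i : 'I_m => option_load c i.+1) (Ordinal im)).
Qed.

Lemma roundedP v j o : 0 <= v ->
  let r := rounded v j o in
  [/\ r.1 = value j o * cap%:R - r.2%:R * v, (r.2 <= cap)%N, 0 < r.1 -> r.2 = cap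
    & r.2%:R * v <= value j o * cap%:R + v].
Proof.
move=> v0; have := round_upP cap v0 (mulrn_wge0 cap (value_ge0 j o)).
by rewrite -/(rounded v j o) -(mulr_natr (value j o)).
Qed.

(** A positive remainder would mean that all [cap] subtractions took place, that is,
    [cap * v < cap * value j o]. *)
Lemma rounded_le0 v j o : value j o <= v -> (rounded v j o).1 <= 0.
Proof.
move=> le; have v0 : 0 <= v := le_trans (value_ge0 _ _) le.
have [E1 _ full _] := roundedP j o v0.
rewrite leNgt; apply/negP => r0; move: (r0); rewrite E1 full //.
have: value j o * cap%:R <= v * cap%:R by apply: ler_wpM2r; rewrite ?ler0n.
lra.
Qed.

Lemma digit_lt v c o : 0 <= v -> (digit v c o < base)%N.
Proof.
move=> v0; rewrite ltnS /digit; apply: (@leq_trans (\sum_(j < n) cap)%N).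
  rewrite big_mkcond /=; apply: leq_sum => j _; case: ifP => // _.
  by case: (roundedP j o v0).
by rewrite sum_nat_const card_ord.
Qed.

Lemma sum_code_weight v c :
  (forall j, j < n -> c j <= m)%N ->
  (forall j, (j < n)%N -> (rounded v j (c j)).1 <= 0) ->
  (\sum_(j < n) code_weight v j (c j) = \sum_(o < m.+1) digit v c o * base ^ o)%N.
Proof.
move=> cm c0.
transitivity (\sum_(j < n) (rounded v j (c j)).2 * base ^ (c j))%N.
  by apply: eq_bigr => j _; rewrite /code_weight ltNge c0.
rewrite (sum_by_choice (V := nat) (fun j o => ((rounded v j o).2 * base ^ o)%N) (M := m.+1)) //.
by apply: eq_bigr => o _; rewrite big_distrl.
Qed.

Lemma sum_code_weight_lt v c : 0 <= v ->
  (forall j, j < n -> c j <= m)%N ->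
  (forall j, (j < n)%N -> value j (c j) <= v) ->
  (\sum_(j < n) code_weight v j (c j) < ncodes)%N.
Proof.
move=> v0 cm cv; rewrite sum_code_weight //; last first.
  by move=> j jn; apply/rounded_le0/cv.
by apply: digits_lt => o; apply: digit_lt.
Qed.

(** No job uses both options, so the errors of one machine and of rejection together amount to [n]
    units rather than [2 n]; this is why [cap] can be [n * k]. *)
Lemma card_two_options c a b : a != b ->
  (#|[pred j : 'I_n | c j == a]| + #|[pred j : 'I_n | c j == b]| <= n)%N.
Proof.
move=> ab; rewrite -!sum1_card !(big_mkcond (fun j => j \in _)) -big_split /=.
rewrite -[leqRHS]card_ord -sum1_card; apply: leq_sum => j _.
by rewrite !inE; case: (c j =P a) => [->|_]; rewrite ?(negPf ab) //; case: eqP.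
Qed.

Lemma option_load_digit v c o : 0 <= v ->
  (forall j, (j < n)%N -> (rounded v j (c j)).1 <= 0) ->
  option_load c o * cap%:R <= (digit v c o)%:R * v.
Proof.
move=> v0 c0; rewrite /option_load /digit natr_sum !mulr_suml.
apply: ler_sum => j /eqP cj; have [E1 _ _ _] := roundedP j o v0.
by have := c0 j (ltn_ord j); rewrite cj E1; lra.
Qed.

Lemma digit_option_load v c o : 0 <= v ->
  (digit v c o)%:R * v <=
    option_load c o * cap%:R + #|[pred j : 'I_n | c j == o]|%:R * v.
Proof.
move=> v0; rewrite /option_load /digit natr_sum !mulr_suml.
rewrite -sum1_card natr_sum mulr_suml -big_split /=.
by apply: ler_sum => j _; rewrite mul1r; case: (roundedP j o v0).
Qed.

(* Equal codes have equal digits, so the loads of both choices agree up to the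
   rounding errors, which are at most [v / cap] per job. *)
Lemma same_code_cost v c c' : (0 < n)%N -> (0 < m)%N -> 0 <= v ->
  (forall j, j < n -> c j <= m)%N -> (forall j, j < n -> c' j <= m)%N ->
  (forall j, (j < n)%N -> (rounded v j (c j)).1 <= 0) ->
  (forall j, (j < n)%N -> (rounded v j (c' j)).1 <= 0) ->
  (\sum_(j < n) code_weight v j (c j) = \sum_(j < n) code_weight v j (c' j))%N ->
  k%:R * choice_cost c <= k%:R * choice_cost c' + v.
Proof.
move=> n0 m0 v0 cm cm' c0 c0'; rewrite !sum_code_weight // => ecode.
have dE o : (o <= m)%N -> digit v c o = digit v c' o.
  by apply: (digits_inj _ _ ecode) => o'; apply: digit_lt.
have n0R : 0 < n%:R :> R by rewrite ltr0n.
(* The makespan is a maximum over machines, so it suffices to bound each machine load together with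
   the penalties. *)
have key i : (i < m)%N ->
    k%:R * (option_load c i.+1 + option_load c 0) <= k%:R * choice_cost c' + v.
  move=> im; rewrite -(ler_pM2l n0R).
  have := option_load_digit i.+1 v0 c0; have := option_load_digit 0 v0 c0.
  have := digit_option_load c' i.+1 v0; have := digit_option_load c' 0 v0.
  rewrite -!dE // /cap natrM.
  have := @card_two_options c' i.+1 0 isT; rewrite -(ler_nat R) natrD.
  move/(ler_wpM2r v0).
  have lc : option_load c' i.+1 + option_load c' 0 <= choice_cost c'.
    rewrite lerD2r.
    exact: (le_bigmax _ (fun i : 'I_m => option_load c' i.+1) (Ordinal im)).
  have := ler_wpM2r (mulr_ge0 (ltW n0R) (ler0n R k)) lc.
  nra.
have [->|k0] := posnP k; first by rewrite !mul0r add0r.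
have k0R : 0 < k%:R :> R by rewrite ltr0n.
set z := k%:R * choice_cost c' + v in key *.
have key' i : (i < m)%N -> option_load c i.+1 + option_load c 0 <= z / k%:R.
  by move=> im; rewrite ler_pdivlMr // mulrC key.
rewrite mulrC -ler_pdivlMr // -lerBrDr; apply/bigmax_leP; split=> [|i _].
  rewrite subr_ge0; apply: le_trans (key' 0%N m0).
  by rewrite lerDr option_load_ge0.
by rewrite lerBrDr key'.
Qed.

(** The recurrence of the dynamic program in two halves: attainment, for entries below [top], which
    allows a choice to be traced back, and minimality, which allows comparison with any other
    choice. The code weights [A] are arbitrary here. *)
Definition cell_spec (A : nat -> nat -> nat) (top : R) (W : nat -> R)
    (j w : nat) (x : R) (a : nat) : Prop :=
  (x < top -> [/\ (a <= m)%N, (A j a <= w)%N &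
     x = W (j * ncodes + (w - A j a))%N + time_of j a]) /\
  (forall o, (o <= m)%N -> (A j o <= w)%N ->
     x <= W (j * ncodes + (w - A j o))%N + time_of j o).

(* Cell [j * ncodes + w] of [W] holds the least total time of a choice for the
   first [j] jobs that has code [w], or [top] if there is none below [top];
   [C] records the option of the last of these jobs. *)
Definition table_spec (A : nat -> nat -> nat) (top : R) (q : nat)
    (W : nat -> R) (C : nat -> nat) : Prop :=
  (forall w, (w < ncodes)%N -> W w = if w == 0%N then 0 else top) /\
  (forall j w, (w < ncodes)%N -> (j.+1 * ncodes + w < q)%N ->
    cell_spec A top W j w (W (j.+1 * ncodes + w)%N) (C (j.+1 * ncodes + w)%N)).

(** The recurrence for a cell refers only to the preceding row, so writing the next cell leaves the
    recurrences already established intact. *)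
Lemma table_spec_upd A top i w W C x a : (w < ncodes)%N ->
  table_spec A top (i.+1 * ncodes + w) W C -> cell_spec A top W i w x a ->
  table_spec A top (i.+1 * ncodes + w).+1
    (upd W (i.+1 * ncodes + w) x) (upd C (i.+1 * ncodes + w) a).
Proof.
set q := (i.+1 * ncodes + w)%N => wT [W0 WS] cell.
have upd_lt q' : (q' < q)%N -> upd W q x q' = W q'.
  by move=> lt; rewrite upd_neq // neq_ltn lt.
split=> [w' w'T|j w' w'T].
  by rewrite upd_lt ?W0 //; rewrite /q mulSn; lia.
rewrite ltnS leq_eqVlt => /orP[/eqP eq|lt].
  have eji : j = i.
    have := congr1 (divn^~ ncodes) eq; rewrite /q !divnMDl ?(leq_trans _ wT) //.
    by rewrite !divn_small // !addn0 => -[].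
  have eww : w' = w by move: eq; rewrite /q eji => /addnI.
  rewrite eji eww -/q !upd_eq; case: cell => c1 c2.
  have low z : upd W q x (i * ncodes + (w - z))%N = W (i * ncodes + (w - z))%N.
    by rewrite upd_lt // /q mulSn; lia.
  by split=> [/c1[]|o om]; rewrite low; [split | exact: c2].
have := WS _ _ w'T lt; set q' := (j.+1 * ncodes + w')%N in lt *.
have low z : upd W q x (j * ncodes + (w' - z))%N = W (j * ncodes + (w' - z))%N.
  by rewrite upd_lt //; apply: leq_trans lt; rewrite ltnS /q' mulSn; lia.
have -> : upd C q a q' = C q' by rewrite upd_neq // neq_ltn lt.
rewrite upd_lt // => -[c1 c2].
by split=> [/c1[]|o om]; rewrite low; [split | exact: c2].
Qed.

Lemma cell_index_lt j w : (j < n)%N -> (w < ncodes)%N ->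
  (j.+1 * ncodes + w < n.+1 * ncodes)%N.
Proof.
move=> jn wT; apply: (@leq_trans (j.+2 * ncodes)); first by rewrite (mulSn j.+1); lia.
by rewrite leq_mul2r ltnS jn orbT.
Qed.

(** Induction along the recurrence. Every partial sum of the code is also below [ncodes], so the
    prefixes of the choice stay inside the table. *)
Lemma table_le (A : nat -> nat -> nat) top W C c j :
  table_spec A top (n.+1 * ncodes) W C ->
  (forall i, i < n -> c i <= m)%N -> (j <= n)%N ->
  (\sum_(i < j) A i (c i) < ncodes)%N ->
  W (j * ncodes + \sum_(i < j) A i (c i))%N <= \sum_(i < j) time_of i (c i).
Proof.
move=> [W0 WS] cm; elim: j => [|j IH] jn; first by rewrite !big_ord0 => lt; rewrite W0.
rewrite !big_ord_recr /=; set w := (\sum_(i < j) _)%N => lt.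
have [_ /(_ (c j) (cm _ jn))] := WS j _ lt (cell_index_lt jn lt).
rewrite leq_addl addnK => /(_ isT) le; apply: le_trans le _.
by rewrite lerD2r; apply: IH; [exact: ltnW | apply: leq_ltn_trans lt; exact: leq_addr].
Qed.

End Selection.

(** * The search *)

Arguments upd T g x v y / : simpl nomatch.

(** * Postconditions and proof rules *)

Section Post.
Variable R : realFieldType.
Implicit Types (s : state R) (c : cmd) (Q : state R -> Prop).

(* A variant rather than a definition, so that unification cannot unfold it. *)
Variant post c s Q : Prop := Post of Q (run c s).

Lemma post_run c s Q : post c s Q -> Q (run c s).
Proof. by case. Qed.

Lemma post_nop s Q : Q s -> post Nop s Q.
Proof. by move=> q; split. Qed.

Lemma post_do i s Q : Q (exec_instr i s) -> post (Do i) s Q.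
Proof. by move=> q; split. Qed.

Lemma post_then c1 c2 s Q :
  post c1 s (fun s' => post c2 s' Q) -> post (Then c1 c2) s Q.
Proof. by case=> -[q]; split. Qed.

Lemma post_cond b c1 c2 s Q :
  (eval_test b s -> post c1 s Q) -> (~~ eval_test b s -> post c2 s Q) ->
  post (Cond b c1 c2) s Q.
Proof.
by move=> H1 H2; split=> /=; case: ifPn => [/H1|/H2]; apply: post_run.
Qed.

Lemma post_use c s Q' Q :
  post c s Q' -> (forall s', agree (writes c) s s' -> Q' s' -> Q s') ->
  post c s Q.
Proof. by case=> H1 H2; split; apply: H2 H1; apply: run_agree. Qed.

Lemma post_for (P : nat -> state R -> Prop) x y b s Q :
  (0%N, x) \notin writes b ->
  P 0%N (set_ireg s x 0) ->
  (forall i s', (i < ireg s y)%N -> agree ((0%N, x) :: writes b) s s' ->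
     ireg s' x = i -> P i s' ->
     post b s' (fun s'' => P i.+1 (set_ireg s'' x i.+1))) ->
  (forall s', agree (writes (For x y b)) s s' -> P (ireg s y) s' -> Q s') ->
  post (For x y b) s Q.
Proof.
move=> xb P0 PS PQ; split; apply: PQ; first exact: run_agree.
by apply: for_ind => // i s' lt ag ex Pi; apply: (post_run (PS _ _ lt ag ex Pi)).
Qed.

End Post.

Ltac expose :=
  cbv beta;
  lazymatch goal with |- post ?c _ _ => let c' := eval hnf in c in change c with c' end.
Ltac next := expose; first [apply: post_do | apply: post_then; apply: post_do].
Ltac seq_for P :=
  expose; first [apply: (post_for (P := P)) => // | apply: post_then; apply: (post_for (P := P)) => //].

Local Notation "c1 ;; c2" := (Then c1 c2) (at level 60, right associativity).
Local Coercion Do : instr >-> cmd.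

(* Registers 0 to 8 for natural numbers hold n, 1, k, m, m + 1, [cap], [base],
   [ncodes] and n (m + 1); registers 0 to 4 for numbers hold the bound U, the
   best cost so far, the current guess, 0 and U + 1.  The arrays for natural
   numbers hold the best choice so far, the powers of [base], the code weights,
   the options recorded with the table, and the choice being evaluated; those
   for numbers hold the processing times, the penalties, the values and times
   of the options, the table, and the loads. *)
Definition weigh_option : cmd :=
  ILoad 14 1 12 ;; IConst 15 0 ;; VLoad 5 2 13 ;; VMove 6 3 ;;
  For 16 5 (VAdd 6 6 5) ;;
  For 16 5 (Cond (VLt 3 6) (VSub 6 6 2 ;; IAdd 15 15 14) Nop) ;;
  Cond (VLt 3 6) (IMove 15 7) Nop ;;
  IStore 2 13 15 ;; IAdd 13 13 1.

Definition weigh : cmd := IConst 13 0 ;; For 11 0 (For 12 4 weigh_option).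

Definition try_option : cmd :=
  IAdd 18 14 17 ;; ILoad 19 2 18 ;;
  Cond (ILe 19 12)
    (ISub 20 16 19 ;; VLoad 6 4 20 ;; VLoad 7 3 18 ;; VAdd 6 6 7 ;;
     Cond (VLt 6 5) (VMove 5 6 ;; IMove 15 17) Nop)
    Nop.

Definition fill_cell : cmd :=
  VMove 5 4 ;; IConst 15 0 ;; ISub 16 13 7 ;;
  For 17 4 try_option ;;
  VStore 4 13 5 ;; IStore 3 13 15 ;; IAdd 13 13 1.

Definition fill_table : cmd :=
  For 11 7 (VStore 4 11 4) ;; IConst 12 0 ;; VStore 4 12 3 ;;
  IMove 13 7 ;; IConst 14 0 ;;
  For 11 0 (For 12 7 fill_cell ;; IAdd 14 14 4).

(** Registers 15, 16 and 17 hold the table position, the job, and the start of the options of that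
    job; all three move one job back. *)
Definition trace_job : cmd :=
  ISub 16 16 1 ;; ISub 17 17 4 ;; ILoad 18 3 15 ;; IStore 4 16 18 ;;
  IAdd 19 17 18 ;; VLoad 6 2 19 ;; VLoad 7 5 18 ;; VAdd 7 7 6 ;;
  VStore 5 18 7 ;; ISub 15 15 7 ;; ILoad 20 2 19 ;; ISub 15 15 20.

Definition trace : cmd :=
  For 12 4 (VStore 5 12 3) ;; IMove 16 0 ;; IMove 17 14 ;; For 12 0 trace_job.

Definition measure : cmd :=
  VMove 6 3 ;;
  For 12 3 (IAdd 19 12 1 ;; VLoad 7 5 19 ;; Cond (VLt 6 7) (VMove 6 7) Nop) ;;
  IConst 19 0 ;; VLoad 7 5 19 ;; VAdd 6 6 7.

Definition keep : cmd :=
  Cond (VLt 6 1) (VMove 1 6 ;; For 12 0 (ILoad 18 4 12 ;; IStore 0 12 18)) Nop.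

Definition eval_code : cmd :=
  ISub 15 13 7 ;; IAdd 15 15 11 ;; VLoad 5 4 15 ;;
  Cond (VLe 5 0) (trace ;; measure ;; keep) Nop.

Definition try_guess : cmd :=
  VLoad 2 2 10 ;; weigh ;; fill_table ;; For 11 7 eval_code.

Definition search : cmd := For 10 8 try_guess.

(** * Arrays indexed by a job and an option *)

Section Filled.
Variables (V : Type) (m : nat).

Definition filled (a : nat -> V) (f : nat -> nat -> V) (q : nat) : Prop :=
  forall j o, (o <= m)%N -> (j * m.+1 + o < q)%N -> a (j * m.+1 + o)%N = f j o.

Lemma flat_inj j o i p : (o <= m)%N -> (p <= m)%N ->
  (j * m.+1 + o = i * m.+1 + p)%N -> j = i /\ o = p.
Proof.
move=> om pm eq; have eji : j = i.
  have := congr1 (divn^~ m.+1) eq.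
  by rewrite !divnMDl // !divn_small ?ltnS // !addn0.
by split=> //; move: eq; rewrite eji => /addnI.
Qed.

Lemma flat_lt n j o : (j < n)%N -> (o <= m)%N -> (j * m.+1 + o < n * m.+1)%N.
Proof.
move=> jn om; apply: (@leq_trans (j.+1 * m.+1)); last by rewrite leq_mul2r jn orbT.
by rewrite mulSn; lia.
Qed.

Lemma filled_upd a f i p : (p <= m)%N -> filled a f (i * m.+1 + p) ->
  filled (upd a (i * m.+1 + p) (f i p)) f (i * m.+1 + p).+1.
Proof.
move=> pm fa j o om; rewrite ltnS leq_eqVlt => /orP[/eqP eq|lt].
  by have [-> ->] := flat_inj om pm eq; rewrite upd_eq.
by rewrite upd_neq ?fa // neq_ltn lt.
Qed.

End Filled.

Lemma sum_nat_upd (V : nmodType) (F : nat -> nat -> V) (t : nat -> nat) j n a :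
  (j < n)%N ->
  \sum_(j <= l < n) F l (upd t j a l) = F j a + \sum_(j.+1 <= l < n) F l (t l).
Proof.
move=> jn; rewrite big_ltn // upd_eq; congr (_ + _).
by apply: eq_big_nat => l /andP[jl _]; rewrite upd_neq // neq_ltn jl orbT.
Qed.

(** * Correctness of the search *)

Section Verify.
Variables (R : realFieldType) (n m k : nat) (P E : nat -> R) (U : R).
Hypotheses (P_ge0 : forall j, 0 <= P j) (E_ge0 : forall j, 0 <= E j).
Implicit Types (s : state R) (v : R).
Local Notation M := m.+1.
Local Notation T := (ncodes n m k).
Local Notation value := (value P E).
Local Notation time_of := (time_of P).
Local Notation code_weight := (code_weight n m k P E).
Local Notation choice_cost := (choice_cost n m P E).

(** Facts established by the initialization and preserved by every part of the search. *)
Definition env s : Prop :=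
  [/\ ireg s 0 = n, ireg s 3 = m, ireg s 4 = M, ireg s 5 = cap n k &
  [/\ ireg s 7 = T, ireg s 8 = (n * M)%N, vreg s 0 = U, vreg s 3 = 0 &
  [/\ vreg s 4 = U + 1, filled m (varr s 2) value (n * M),
      filled m (varr s 3) time_of (n * M),
      forall o, (o <= m)%N -> iarr s 1 o = (base n k ^ o)%N & ireg s 1 = 1%N]]].

Lemma env_agree ws s s' : agree ws s s' ->
  all (fun x => x \notin ws)
    [:: (0, 0); (0, 1); (0, 3); (0, 4); (0, 5); (0, 7); (0, 8); (2, 0); (2, 3); (2, 4);
        (3, 2); (3, 3); (1, 1)]%N ->
  env s -> env s'.
Proof.
move=> [a0 a1 a2 a3] /=; rewrite andbT => H; do 12 case/andP: H => ? H.
by rewrite /env !a0 // !a1 // !a2 // !a3.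
Qed.

Lemma weigh_option_spec s v i p : env s -> 0 <= v -> vreg s 2 = v ->
  (i < n)%N -> (p <= m)%N -> ireg s 12 = p -> ireg s 13 = (i * M + p)%N ->
  filled m (iarr s 2) (code_weight v) (i * M + p) ->
  post weigh_option s (fun s' => ireg s' 13 = (i * M + p).+1 /\
    filled m (iarr s' 2) (code_weight v) (i * M + p).+1).
Proof.
move=> [en em eM ecap [eT eQ eU e0 [einf fval ftime epow e1]]] v0 ev lin lpm ep eq fA.
do 4 next => /=.
seq_for (fun t s' => vreg s' 6 = value i p *+ t) => /=.
  move=> t s' _ [_ _ agv _] _ IH; next; rewrite /= IH agv //= eq fval ?flat_lt //.
  by rewrite mulrSr.
rewrite ecap => s1 [agi1 aga1 agv1 agA1] x1 /=.
have {agi1 aga1 agv1 agA1}[e14 e15 e5 e7 [[e11 e13] e2 e3 a2]] :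
  [/\ ireg s1 14 = (base n k ^ p)%N, ireg s1 15 = 0%N, ireg s1 5 = cap n k,
   ireg s1 7 = T & [/\ ireg s1 1 = 1%N /\ ireg s1 13 = (i * M + p)%N, vreg s1 2 = v, vreg s1 3 = 0
   & iarr s1 2 = iarr s 2]].
  by rewrite !agi1 //= !agv1 //= aga1 //= ep epow.
(* Each subtraction adds [base ^ p], so the count is obtained already multiplied by its place value,
   as [code_weight] requires. *)
seq_for (fun t s' => (vreg s' 6 = (round_up v (value i p *+ cap n k) t).1) /\
   ireg s' 15 = ((round_up v (value i p *+ cap n k) t).2 * base n k ^ p)%N) => /=.
  move=> t s' _ [agi _ agv _] _ [IH1 IH2]; rewrite -/(round_up _ _ _) /round_step -IH1.
  apply: post_cond => /=; rewrite (agv 3) // e3 => x0.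
    by do 2 next; rewrite /= x0 IH2 (agv 2) // (agi 14) // e2 e14 mulSn addnC.
  by apply: post_nop; rewrite /= (negPf x0).
rewrite e5 => s2 [agi aga agv _] [x2 y2] /=.
apply: post_then.
apply: (@post_use _ _ _ (fun s' => ireg s' 15 = code_weight v i p)).
  rewrite /code_weight /rounded -x2.
  apply: post_cond => /=; rewrite (agv 3) // e3 => x0.
    by next; rewrite /= agi // e7 x0.
  by apply: post_nop; rewrite y2 (negPf x0).
move=> s3 [agi3 aga3 _ _] e153; do 2 next => /=.
rewrite e153 !agi3 // !agi // e11 e13 addn1 aga3 // aga // a2; split=> //.
exact: filled_upd.
Qed.

Lemma weigh_spec s v : env s -> 0 <= v -> vreg s 2 = v ->
  post weigh s (fun s' => filled m (iarr s' 2) (code_weight v) (n * M)).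
Proof.
move=> es v0 ev; next => /=.
apply: (post_for (P := fun i s' => ireg s' 13 = (i * M)%N /\
  filled m (iarr s' 2) (code_weight v) (i * M))) => //=; last first.
  by case: es => -> _ _ _ _ s' _ [].
move=> i s1 lin ag1 _ [e13 f1].
have es1 : env s1 by apply: env_agree ag1 _ es.
have ev1 : vreg s1 2 = v by case: ag1 => _ _ agv _; rewrite agv.
case: es => en _ _ _ _; rewrite en in lin.
apply: (post_for (P := fun p s' => ireg s' 13 = (i * M + p)%N /\
  filled m (iarr s' 2) (code_weight v) (i * M + p))) => //=.
- by rewrite addn0.
- case: (es1) => _ _ -> _ _ p s2 lpm ag2 e12 [e132 f2].
  have es2 : env s2 by apply: env_agree ag2 _ es1.
  have ev2 : vreg s2 2 = v by case: ag2 => _ _ agv _; rewrite agv.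
  apply: post_use (weigh_option_spec es2 v0 ev2 lin lpm e12 e132 f2) _ => s3 _ /=.
  by rewrite addnS.
- by case: (es1) => _ _ -> _ _ s2 _; rewrite -mulSnr.
Qed.


(** Infinity for the table: any number above [U] serves, as only cells of time at most [U] are ever
    traced back. *)
Local Notation top := (U + 1).
Local Notation table_spec := (table_spec n m k P).

Lemma fill_cell_spec s A i w : env s -> (i < n)%N -> (w < T)%N ->
  filled m (iarr s 2) A (n * M) ->
  ireg s 12 = w -> ireg s 13 = (i.+1 * T + w)%N -> ireg s 14 = (i * M)%N ->
  table_spec A top (i.+1 * T + w) (varr s 4) (iarr s 3) ->
  post fill_cell s (fun s' => ireg s' 13 = (i.+1 * T + w).+1 /\
    table_spec A top (i.+1 * T + w).+1 (varr s' 4) (iarr s' 3)).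
Proof.
move=> [en em eM ecap [eT eQ eU e0 [einf fval ftime epow e1]]].
move=> lin lwT fA e12 e13 e14 tab.
do 3 next => /=.
pose W := varr s 4.
seq_for (fun p s' =>
  (vreg s' 5 < top -> [/\ (ireg s' 15 <= m)%N, (A i (ireg s' 15) <= w)%N &
     vreg s' 5 = W (i * T + (w - A i (ireg s' 15)))%N + time_of i (ireg s' 15)]) /\
  (forall o, (o < p)%N -> (A i o <= w)%N ->
     vreg s' 5 <= W (i * T + (w - A i o))%N + time_of i o)) => /=.
- by rewrite einf ltxx.
- rewrite eM => p s1 lpm [agi aga agv agA] e17 [IH1 IH2].
  have lo : (i * M + p < n * M)%N by apply: flat_lt.
  do 2 next => /=.
  rewrite (agi 14) //= e14 e17 aga //= fA //.
  apply: post_cond => /=; rewrite (agi 12) //= e12 => Aw.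
    do 4 next => /=.
    rewrite agA // (agi 16) //= e13 eT -/W.
    rewrite [varr s1 3]agA // ftime //.
    (* Going back by [T] positions reaches the same code in the previous row; the weight of the
       option is then deducted from the code. *)
    have -> : (i.+1 * T + w - T - A i p = i * T + (w - A i p))%N.
      by rewrite mulSn; lia.
    apply: post_cond => /= cmp.
      do 2 next => /=; rewrite e17; split=> // o; rewrite ltnS leq_eqVlt.
      case/orP=> [/eqP->//|op] /(IH2 _ op) le; apply: le_trans le; exact: ltW.
    apply: post_nop; split=> //= o; rewrite ltnS leq_eqVlt.
    case/orP=> [/eqP-> _|op]; last exact: IH2.
    by rewrite leNgt.
  apply: post_nop; split=> //= o; rewrite ltnS leq_eqVlt.
  by case/orP=> [/eqP->|]; [rewrite (negPf Aw) | exact: IH2].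
rewrite eM => s1 [agi aga agv agA] [H1 H2].
do 3 next => /=.
rewrite (agi 13) // (agi 1) //= e1 e13 addn1; split=> //.
rewrite agA // aga // /=.
by apply: table_spec_upd => //; split=> // o om; apply: H2.
Qed.

Lemma fill_table_spec s A : env s -> filled m (iarr s 2) A (n * M) ->
  post fill_table s (fun s' => [/\ ireg s' 13 = (n.+1 * T)%N, ireg s' 14 = (n * M)%N &
    table_spec A top (n.+1 * T) (varr s' 4) (iarr s' 3)]).
Proof.
move=> es fA; have eT : ireg s 7 = T by case: es => _ _ _ _ [].
have e4 : vreg s 4 = top by case: es => _ _ _ _ [_ _ _ _ []].
have e3 : vreg s 3 = 0 by case: es => _ _ _ _ [].
seq_for (fun i s' => forall w, (w < i)%N -> varr s' 4 w = top) => /=.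
  move=> i s1 _ [_ _ agv _] e11 IH; next => /= w.
  rewrite ltnS leq_eqVlt e11 (agv 4) //= e4 => /orP[/eqP->|lt]; first by rewrite upd_eq.
  by rewrite upd_neq ?IH // neq_ltn lt.
rewrite eT => s1 ag1 W1.
have es1 : env s1 by apply: env_agree ag1 _ es.
have fA1 : filled m (iarr s1 2) A (n * M).
  by case: ag1 => _ aga _ _; rewrite aga.
have {e3} e3 : vreg s1 3 = 0 by case: es1 => _ _ _ _ [].
do 4 next => /=.
set s2 := set_ireg _ 14 _.
have es2 : env s2 := es1.
have fA2 : filled m (iarr s2 2) A (n * M) := fA1.
(* Only row 0 is present so far: without jobs, code 0 has time 0 and every other code is out of
   reach. *)
have tab2 : table_spec A top T (varr s2 4) (iarr s2 3).
  split=> [w wT|j w wT]; last by rewrite mulSn; lia.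
  by rewrite /s2 /= /upd; case: eqP => // _; apply: W1.
move: s2 es2 fA2 tab2 (erefl : ireg s2 13 = ireg s1 7) (erefl : ireg s2 14 = 0%N).
move=> s2 es2 fA2 tab2 + e14; have -> : ireg s1 7 = T by case: es1 => _ _ _ _ [].
move=> e13.
apply: (post_for (P := fun i s' => [/\ ireg s' 13 = (i.+1 * T)%N, ireg s' 14 = (i * M)%N &
    table_spec A top (i.+1 * T) (varr s' 4) (iarr s' 3)])) => //=.
- by rewrite mul1n.
- case: (es2) => -> _ _ _ _ i s3 lin ag3 _ [f13 f14 tab3].
  have es3 : env s3 by apply: env_agree ag3 _ es2.
  have fA3 : filled m (iarr s3 2) A (n * M).
    by case: ag3 => _ aga _ _; rewrite aga.
  seq_for (fun w s' => ireg s' 13 = (i.+1 * T + w)%N /\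
    table_spec A top (i.+1 * T + w) (varr s' 4) (iarr s' 3)) => /=.
  + by rewrite addn0.
  + case: (es3) => _ _ _ _ [-> _ _ _ _] w s4 lwT ag4 e12 [g13 tab4].
    have es4 : env s4 by apply: env_agree ag4 _ es3.
    case: ag4 => agi aga _ _.
    have fA4 : filled m (iarr s4 2) A (n * M) by rewrite aga.
    have g14 : ireg s4 14 = (i * M)%N by rewrite agi.
    apply: post_use (fill_cell_spec es4 lin lwT fA4 e12 g13 g14 tab4) _ => s5 _ /=.
    by rewrite addnS.
  + case: (es3) => _ _ eM _ [-> _ _ _ _] s4 [agi _ _ _]; rewrite -mulSnr => -[g13 tab4].
    next => /=; split=> //.
    by rewrite !agi // f14 eM -mulSnr.
- by case: (es2) => -> _ _ _ _ s3 _.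
Qed.

Lemma trace_spec s A w : env s -> filled m (iarr s 2) A (n * M) ->
  table_spec A top (n.+1 * T) (varr s 4) (iarr s 3) ->
  ireg s 14 = (n * M)%N -> ireg s 15 = (n * T + w)%N -> (w < T)%N ->
  varr s 4 (n * T + w)%N <= U ->
  post trace s (fun s' =>
    [/\ forall l, (l < n)%N -> (iarr s' 4 l <= m)%N,
        (\sum_(l < n) A l (iarr s' 4 l))%N = w,
        \sum_(l < n) time_of l (iarr s' 4 l) = varr s 4 (n * T + w)%N &
        forall o, (o <= m)%N -> varr s' 5 o = option_load n P E (iarr s' 4) o]).
Proof.
move=> [en em eM ecap [eT eQ eU e0 [einf fval ftime epow e1]]] fA [tab0 tab] e14 e15 lwT WU.
seq_for (fun o s' => forall o', (o' < o)%N -> varr s' 5 o' = 0) => /=.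
  move=> o s1 _ [_ _ agv _] e12 IH; next => /= o'.
  rewrite ltnS leq_eqVlt e12 (agv 3) //= e0 => /orP[/eqP->|lt]; first by rewrite upd_eq.
  by rewrite upd_neq ?IH // neq_ltn lt.
rewrite eM => s1 [agi1 aga1 agv1 agA1] load0.
do 2 next => /=.
pose W := varr s 4.
(* The jobs from [j] on are decided and [w'] is the code left for the earlier jobs; the time of the
   decided jobs plus the cell reached equals the starting cell. *)
pose inv j w' (t : nat -> nat) (L : nat -> R) :=
  [/\ (forall l, (j <= l < n)%N -> (t l <= m)%N),
      (w' + \sum_(j <= l < n) A l (t l))%N = w,
      W (j * T + w')%N + \sum_(j <= l < n) time_of l (t l) = W (n * T + w)%N &
      forall o, (o <= m)%N ->
        L o = \sum_(j <= l < n) (if t l == o then value l o else 0)].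
seq_for (fun i s' => let j := (n - i)%N in
  exists2 w', [/\ ireg s' 16 = j, ireg s' 17 = (j * M)%N, ireg s' 15 = (j * T + w')%N,
    (w' < T)%N & W (j * T + w')%N <= U] & inv j w' (iarr s' 4) (varr s' 5)) => /=.
- exists w; rewrite subn0; first by rewrite agi1 //= en agi1 //= e14 agi1 //= e15.
  rewrite /inv !big_geq // addn0 addr0; split=> // [l lP|o om]; first by lia.
  by rewrite big_geq // load0.
- rewrite agi1 //= en => i s2 lin [agi aga agv agA] _ [w' [e16 e17 e15' lw'T W'U] [Im Iw IW IL]].
  have ej : (n - i)%N = (n - i.+1).+1 by lia.
  move: (n - i.+1)%N ej => j ej; rewrite ej in e16 e17 e15' W'U Im Iw IW IL.
  have ljn : (j < n)%N by lia.
  have [c1 _] := tab _ _ lw'T (cell_index_lt ljn lw'T).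
  (* The cell is at most [U], hence below [top], so its recorded option is genuine. *)
  have {c1}[] := c1; first by apply: le_lt_trans W'U _; rewrite ltrDl.
  set o := iarr s 3 _ => om Aw Wq.
  have e11 : ireg s2 1 = 1%N by rewrite agi //= agi1.
  have e4 : ireg s2 4 = M by rewrite agi //= agi1.
  have e7 : ireg s2 7 = T by rewrite agi //= agi1.
  have a3 : iarr s2 3 = iarr s 3 by rewrite aga //= aga1.
  have a2 : iarr s2 2 = iarr s 2 by rewrite aga //= aga1.
  have A2 : varr s2 2 = varr s 2 by rewrite agA //= agA1.
  do 12 next => /=.
  rewrite e16 e17 e15' a3 a2 A2 e11 e4 e7 -/o subn1 /= mulSnr addnK.
  have lq : (j * M + o < n * M)%N by apply: flat_lt.
  rewrite fval // fA //.
  have -> : (j.+1 * T + w' - T - A j o = j * T + (w' - A j o))%N by rewrite mulSn; lia.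
  exists (w' - A j o)%N.
    split=> //; first by apply: leq_ltn_trans lw'T; apply: leq_subr.
    by apply: le_trans W'U; rewrite /W Wq lerDl time_of_ge0.
  split.
  + move=> l /andP[jl ln]; rewrite /upd; case: eqP => // lj; apply: Im; lia.
  + by rewrite (sum_nat_upd (V := nat) A) // -[RHS]Iw addnA subnK.
  + by rewrite (sum_nat_upd time_of) // addrA -Wq.
  + move=> o' om'.
    rewrite (sum_nat_upd (fun l x => if x == o' then value l o' else 0)) //.
    rewrite -IL // /upd eq_sym; case: eqP => [->|_]; last by rewrite add0r.
    by rewrite addrC.
rewrite agi1 //= en subnn => s2 _ [w' [_ _ _ lw'T]]; rewrite mul0n add0n => W'U.
(* In row 0 only code 0 has an entry at most [U], so the code is used up exactly. *)
have w'0 : w' = 0%N.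
  apply/eqP; apply/negPn/negP => w0; move: W'U; rewrite /W tab0 // (negPf w0).
  by rewrite leNgt ltrDl ltr01.
rewrite /inv w'0 mul0n add0n {1}/W tab0 ?(leq_ltn_trans _ lwT) // eqxx !add0r !big_mkord.
case=> H1 H2 H3 H4; split=> // o om.
by rewrite H4 // big_mkord -big_mkcond.
Qed.

Lemma measure_spec s (L : nat -> R) : env s -> (forall o, 0 <= L o) ->
  (forall o, (o <= m)%N -> varr s 5 o = L o) ->
  post measure s (fun s' =>
    vreg s' 6 = \big[Num.max/0]_(i < m) L i.+1 + L 0%N).
Proof.
move=> [en em eM ecap [eT eQ eU e0 [einf fval ftime epow e1]]] L0 eL.
next => /=.
(* The running maximum bounds the loads seen and is 0 or one of them; the case 0 matches the default
   value of the iterated maximum. *)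
seq_for (fun p s' => [/\ 0 <= vreg s' 6, forall i, (i < p)%N -> L i.+1 <= vreg s' 6 &
   vreg s' 6 = 0 \/ exists2 i, (i < p)%N & vreg s' 6 = L i.+1]) => /=.
- by rewrite e0; split=> //; left.
- rewrite em => p s1 lpm [agi _ _ agA] e12 [I0 Ile Iex].
  do 2 next => /=.
  rewrite (agi 1) //= e1 e12 addn1 agA //= eL //.
  apply: post_cond => /= cmp.
    next => /=; split=> // [i|]; last by right; exists p.
    rewrite ltnS leq_eqVlt => /orP[/eqP->//|/Ile le].
    by apply: le_trans le _; apply: ltW.
  apply: post_nop => /=; split=> // [i|].
    rewrite ltnS leq_eqVlt => /orP[/eqP->|/Ile//].
    by rewrite leNgt.
  by case: Iex => [|[i ip ei]]; [left | right; exists i => //; exact: leqW].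
rewrite em => s1 [_ _ _ agA] [I0 Ile Iex]; do 3 next => /=.
rewrite agA //= eL //; congr (_ + _); apply/le_anti/andP; split; last first.
  by apply/bigmax_leP; split=> // i _; apply: Ile.
case: Iex => [->|[i im ->]]; first exact: bigmax_ge_id.
exact: (le_bigmax _ (fun i : 'I_m => L i.+1) (Ordinal im)).
Qed.

Definition sound s : Prop :=
  [/\ forall j, (j < n)%N -> (iarr s 0 j <= m)%N,
      \sum_(j < n) time_of j (iarr s 0 j) <= U &
      vreg s 1 = choice_cost (iarr s 0)].

Lemma keep_spec s : env s -> sound s ->
  (forall j, (j < n)%N -> (iarr s 4 j <= m)%N) ->
  \sum_(j < n) time_of j (iarr s 4 j) <= U ->
  vreg s 6 = choice_cost (iarr s 4) ->
  post keep s (fun s' => [/\ sound s', vreg s' 1 <= vreg s 1 &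
    vreg s' 1 <= choice_cost (iarr s 4)]).
Proof.
move=> [en _ _ _ _] sd tm tU e6; expose; apply: post_cond => /= cmp; last first.
  by apply: post_nop; split=> //; rewrite -e6 leNgt.
next => /=.
apply: (post_for (P := fun i s' => forall j, (j < i)%N -> iarr s' 0 j = iarr s 4 j)) => //=.
  move=> i s1 _ [_ aga _ _] e12 IH; do 2 next; move=> /= j.
  rewrite ltnS leq_eqVlt e12 (aga 4) //= => /orP[/eqP->|lt]; first by rewrite upd_eq.
  by rewrite upd_neq ?IH // neq_ltn lt.
rewrite en => s1 [_ _ agv _] out.
rewrite /sound (agv 1) //= e6; split; last by [].
  split.
  - by move=> j jn; rewrite out // tm.
  - by under eq_bigr => j _ do rewrite out //.
  - by apply: eq_choice_cost => j jn; rewrite out.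
by rewrite -e6 ltW.
Qed.

(** The witness is the choice traced back from the cell. Only its code matters for the comparison
    with an optimal solution, not which choice it is. *)
Lemma eval_code_spec s A w : env s -> sound s -> filled m (iarr s 2) A (n * M) ->
  table_spec A top (n.+1 * T) (varr s 4) (iarr s 3) ->
  ireg s 13 = (n.+1 * T)%N -> ireg s 14 = (n * M)%N ->
  ireg s 11 = w -> (w < T)%N ->
  post eval_code s (fun s' => [/\ sound s', vreg s' 1 <= vreg s 1 &
    varr s 4 (n * T + w)%N <= U ->
    exists c : nat -> nat, [/\ forall j, (j < n)%N -> (c j <= m)%N,
      (\sum_(j < n) A j (c j))%N = w & vreg s' 1 <= choice_cost c]]).
Proof.
move=> es sd fA tab e13 e14 e11 lwT.
do 3 next => /=.
have -> : (ireg s 13 - ireg s 7 + ireg s 11 = n * T + w)%N.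
  by case: (es) => _ _ _ _ [-> _ _ _ _]; rewrite e13 e11 mulSnr addnK.
set s1 := set_vreg _ 5 _.
have e15 : ireg s1 15 = (n * T + w)%N by [].
have es1 : env s1 := es; have sd1 : sound s1 := sd.
have fA1 : filled m (iarr s1 2) A (n * M) := fA.
have tab1 : table_spec A top (n.+1 * T) (varr s1 4) (iarr s1 3) := tab.
have e141 : ireg s1 14 = (n * M)%N := e14.
change (varr s 4) with (varr s1 4); change (vreg s 1) with (vreg s1 1).
have eU : vreg s1 0 = U by case: es1 => _ _ _ _ [].
have e5 : vreg s1 5 = varr s1 4 (n * T + w)%N by [].
move: s1 e15 es1 sd1 fA1 tab1 e141 eU e5.
move=> {s es sd fA tab e13 e14 e11} s e15 es sd fA tab e14 eU e5.
apply: post_cond; rewrite /= e5 eU => WU; last first.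
  by apply: post_nop; split=> // le; rewrite le in WU.
apply: post_then.
apply: post_use (trace_spec es fA tab e14 e15 lwT WU) _ => s1 ag1 [tm tw tt tl].
have es1 : env s1 by apply: env_agree ag1 _ es.
case: ag1 => agi1 aga1 agv1 agA1.
apply: post_then.
apply: post_use (measure_spec es1 (option_load_ge0 _ P_ge0 E_ge0 _) tl) _ => s2 ag2 e6.
have es2 : env s2 by apply: env_agree ag2 _ es1.
case: ag2 => agi2 aga2 agv2 agA2.
have a4 : iarr s2 4 = iarr s1 4 by rewrite aga2.
have v1 : vreg s2 1 = vreg s 1 by rewrite agv2 //= agv1.
have sd2 : sound s2 by rewrite /sound aga2 //= aga1 // v1.
apply: post_use (keep_spec es2 sd2 _ _ _) _; rewrite ?a4 ?tt //.
move=> s3 _ [sd3 le1 le2]; rewrite -v1; split=> // _.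
by exists (iarr s1 4).
Qed.

(** The guarantee due to the guess [v]: an additive error of [v / k], stated without division. *)
Definition covers s v : Prop :=
  forall c : nat -> nat, (forall j, (j < n)%N -> (c j <= m)%N) ->
    \sum_(j < n) time_of j (c j) <= U ->
    (forall j, (j < n)%N -> value j (c j) <= v) ->
    k%:R * vreg s 1 <= k%:R * choice_cost c + v.

Lemma covers_le s s' v : vreg s' 1 <= vreg s 1 -> covers s v -> covers s' v.
Proof.
move=> le cov c c1 c2 c3; apply: le_trans (cov c c1 c2 c3).
by rewrite ler_wpM2l // ler0n.
Qed.

Hypothesis m_gt0 : (0 < m)%N.

(** For a feasible choice with values at most [v], the cell of its code is at most its time, hence
    at most [U]. The choice traced back from that cell has the same code, so [same_code_cost]
    compares the two costs. *)
Lemma try_guess_spec s g : env s -> sound s -> ireg s 10 = g -> (g < n * M)%N ->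
  post try_guess s (fun s' => [/\ sound s', vreg s' 1 <= vreg s 1 &
    covers s' (varr s 2 g)]).
Proof.
move=> es sd e10 lg.
have n0 : (0 < n)%N by case: (n) lg.
have gE : varr s 2 g = value (g %/ M) (g %% M).
  case: (es) => _ _ _ _ [_ _ _ _ [_ fval _ _ _]].
  by rewrite {1}(divn_eq g M) fval -?divn_eq // -ltnS ltn_mod.
set v := varr s 2 g in gE *.
have v0 : 0 <= v by rewrite gE value_ge0.
next => /=; rewrite e10 -/v.
set s1 := set_vreg _ 2 _.
have es1 : env s1 := es; have sd1 : sound s1 := sd.
change (vreg s 1) with (vreg s1 1); have e2 : vreg s1 2 = v by [].
move: s1 es1 sd1 e2 => s1 es1 sd1 e2.
apply: post_then.
apply: post_use (weigh_spec es1 v0 e2) _ => s2 ag2 fA2.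
have es2 : env s2 by apply: env_agree ag2 _ es1.
apply: post_then.
apply: post_use (fill_table_spec es2 fA2) _ => s3 ag3 [e13 e14 tab].
have es3 : env s3 by apply: env_agree ag3 _ es2.
case: ag2 => agi2 aga2 agv2 agA2; case: ag3 => agi3 aga3 agv3 agA3.
have v13 : vreg s3 1 = vreg s1 1 by rewrite agv3 //= agv2.
have sd3 : sound s3 by rewrite /sound aga3 //= aga2 // v13.
have fA3 : filled m (iarr s3 2) (code_weight v) (n * M) by rewrite aga3.
rewrite -v13.
apply: (post_for (P := fun w s' => [/\ sound s', vreg s' 1 <= vreg s3 1 &
  forall w', (w' < w)%N -> varr s3 4 (n * T + w')%N <= U ->
    exists c : nat -> nat, [/\ forall j, (j < n)%N -> (c j <= m)%N,
      (\sum_(j < n) code_weight v j (c j))%N = w' & vreg s' 1 <= choice_cost c]])) => //=.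
  case: (es3) => _ _ _ _ [-> _ _ _ _] w s4 lwT ag4 e11 [sd4 le4 IH].
  have es4 : env s4 by apply: env_agree ag4 _ es3.
  case: ag4 => agi4 aga4 agv4 agA4.
  have a2 : iarr s4 2 = iarr s3 2 by rewrite aga4.
  have a3 : iarr s4 3 = iarr s3 3 by rewrite aga4.
  have A4 : varr s4 4 = varr s3 4 by rewrite agA4.
  apply: post_use (@eval_code_spec s4 (code_weight v) w es4 sd4 _ _ _ _ e11 lwT) _.
  - by rewrite a2.
  - by rewrite A4 a3.
  - by rewrite agi4.
  - by rewrite agi4.
  move=> s5 _ /=; rewrite A4 => -[sd5 le5 ex5]; split=> //; first exact: le_trans le4.
  move=> w'; rewrite ltnS leq_eqVlt => /orP[/eqP->//|lt WU].
  have [c [c1 c2 c3]] := IH _ lt WU; exists c; split=> //; exact: le_trans c3.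
case: (es3) => _ _ _ _ [-> _ _ _ _] s4 _ [sd4 le4 all4]; split=> // c c1 c2 c3.
have lt : (\sum_(j < n) code_weight v j (c j) < T)%N.
  exact: sum_code_weight_lt.
have leW := table_le tab c1 (leqnn n) lt.
have [c' [c'1 c'2 c'3]] := all4 _ lt (le_trans leW c2).
apply: (@le_trans _ _ (k%:R * choice_cost c')); first by rewrite ler_wpM2l ?ler0n.
apply: (same_code_cost P_ge0 E_ge0) => //.
  (* A value that is too large would contribute the weight [ncodes] by itself, more than the whole
     code. *)
  move=> j jn; rewrite leNgt; apply/negP => pos.
  have : (code_weight v j (c' j) <= \sum_(j < n) code_weight v j (c' j))%N.
    by rewrite (bigD1 (Ordinal jn)) //= leq_addr.
  by rewrite c'2 leqNgt => /negP[]; apply: leq_trans lt _; rewrite /code_weight pos.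
by move=> j jn; apply: rounded_le0 => //; apply: c3.
Qed.

(** The guesses run through all values of all options, and earlier guarantees survive because the
    best cost never increases. *)
Lemma search_spec s : env s -> sound s ->
  post search s (fun s' => sound s' /\ forall j o, (j < n)%N -> (o <= m)%N ->
    covers s' (value j o)).
Proof.
move=> es sd.
apply: (post_for (P := fun g s' => sound s' /\
  forall g', (g' < g)%N -> covers s' (varr s 2 g'))) => //=.
  case: (es) => _ _ _ _ [_ -> _ _ _] g s1 lg ag1 e10 [sd1 cov].
  have es1 : env s1 by apply: env_agree ag1 _ es.
  apply: post_use (try_guess_spec es1 sd1 e10 lg) _ => s2 _ [sd2 le2 cov2].
  split=> // g'; rewrite ltnS leq_eqVlt => /orP[/eqP->|lt].
    by case: ag1 cov2 => _ _ _ ->.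
  by apply: (covers_le le2); apply: cov.
case: (es) => _ _ _ _ [_ -> _ _ [_ fval _ _ _]] s1 _ [sd1 cov]; split=> // j o jn om.
by have := cov _ (flat_lt jn om); rewrite fval // flat_lt.
Qed.

End Verify.

(** * Initialization *)

Definition constants (m k : nat) : cmd :=
  IConst 2 k ;; IConst 3 m ;; IConst 4 m.+1 ;; VConst 5 1 ;; VAdd 4 0 5.

Definition sizes : cmd :=
  For 10 0 (IAdd 5 5 2) ;; IConst 6 1 ;; For 10 0 (IAdd 6 6 5).

(** Besides tabulating values and times, this sums the penalties into register 1 for numbers: the
    cost of rejecting every job, which is the initial best choice. *)
Definition options : cmd :=
  For 10 0
    (VLoad 5 1 10 ;; VStore 2 8 5 ;; VStore 3 8 3 ;; VAdd 1 1 5 ;; IAdd 8 8 1 ;;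
     VLoad 5 0 10 ;; For 11 3 (VStore 2 8 5 ;; VStore 3 8 5 ;; IAdd 8 8 1)).

(** Multiplication is done by repeated addition. The last product, which remains in register 7, is
    [ncodes]. *)
Definition powers : cmd :=
  IConst 7 1 ;;
  For 10 4 (IStore 1 10 7 ;; IConst 12 0 ;; For 11 6 (IAdd 12 12 7) ;; IMove 7 12).

Section Setup.
Variables (R : realFieldType) (n m k : nat) (P E : nat -> R) (U : R).
Hypothesis U_ge0 : 0 <= U.
Implicit Types s : state R.

Lemma sizes_spec s : ireg s 0 = n -> ireg s 2 = k -> ireg s 5 = 0%N ->
  post sizes s (fun s' => ireg s' 5 = cap n k /\ ireg s' 6 = base n k).
Proof.
move=> en ek e5.
seq_for (fun i s' => ireg s' 5 = (i * k)%N).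
  by move=> i s1 _ [agi _ _ _] _ IH; next; rewrite /= IH agi //= ek mulSnr.
rewrite en => s1 [agi1 _ _ _] e51; next => /=.
seq_for (fun i s' => ireg s' 6 = (i * cap n k).+1) => /=.
  by move=> i s2 _ [agi2 _ _ _] _ IH; next; rewrite /= IH agi2 //= e51 mulSnr.
by rewrite agi1 // en => s2 [agi2 _ _ _] e6; rewrite agi2.
Qed.

Lemma options_spec s : ireg s 0 = n -> ireg s 1 = 1%N -> ireg s 3 = m ->
  ireg s 8 = 0%N -> vreg s 1 = 0 -> vreg s 3 = 0 ->
  varr s 0 = P -> varr s 1 = E ->
  post options s (fun s' => [/\ ireg s' 8 = (n * m.+1)%N,
    filled m (varr s' 2) (value P E) (n * m.+1),
    filled m (varr s' 3) (time_of P) (n * m.+1) &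
    vreg s' 1 = \sum_(j < n) E j]).
Proof.
move=> en e1 em e8 v1 v3 a0 a1.
apply: (post_for (P := fun i s' => [/\ ireg s' 8 = (i * m.+1)%N,
    filled m (varr s' 2) (value P E) (i * m.+1),
    filled m (varr s' 3) (time_of P) (i * m.+1) &
    vreg s' 1 = \sum_(j < i) E j])) => //=.
- by rewrite v1 big_ord0.
- move=> i s1 _ [agi _ agv agA] e10 [I8 If It I1].
  do 6 next => /=.
  rewrite I8 agA //= a1 e10 agA //= a0 (agv 3) //= v3 I1 (agi 1) //= e1.
  set s2 := set_vreg _ 5 _.
  seq_for (fun p s' => [/\ ireg s' 8 = (i * m.+1 + p.+1)%N,
    filled m (varr s' 2) (value P E) (i * m.+1 + p.+1) &
    filled m (varr s' 3) (time_of P) (i * m.+1 + p.+1)]) => /=.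
  + rewrite !addn1 -[(i * m.+1)%N]addn0.
    by split=> //; [apply: (filled_upd (f := value P E)) | apply: (filled_upd (f := time_of P))];
      rewrite ?addn0.
  + rewrite agi //= em => p s3 lpm [agi3 _ agv3 _] _ [J8 Jf Jt].
    do 3 next => /=; rewrite J8 (agi3 1) //= (agi 1) //= e1 agv3 //= addn1 (addnS _ p.+1).
    by split=> //; [exact: (@filled_upd _ m _ (value P E)) | exact: (@filled_upd _ m _ (time_of P))].
  + rewrite agi //= em -mulSnr => s3 [_ _ agv3 _] [J8 Jf Jt]; split=> //.
    by rewrite agv3 //= big_ord_recr.
- by rewrite en => s1 _.
Qed.

Lemma powers_spec s : ireg s 4 = m.+1 -> ireg s 6 = base n k ->
  post powers s (fun s' => ireg s' 7 = ncodes n m k /\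
    forall o, (o <= m)%N -> iarr s' 1 o = (base n k ^ o)%N).
Proof.
move=> eM eB; next => /=.
seq_for (fun p s' => ireg s' 7 = (base n k ^ p)%N /\
    forall o, (o < p)%N -> iarr s' 1 o = (base n k ^ o)%N) => /=.
  move=> p s1 _ [agi1 _ _ _] e10 [I7 IP].
  do 2 next => /=.
  seq_for (fun i s' => ireg s' 12 = (i * base n k ^ p)%N) => /=.
    by move=> i s2 _ [agi2 _ _ _] _ IH; next; rewrite /= IH agi2 //= I7 mulSnr.
  rewrite (agi1 6) //= eB => s2 [_ aga2 _ _] e12; next => /=; rewrite e12 expnS; split=> // o.
  rewrite ltnS leq_eqVlt aga2 //= e10 I7 => /orP[/eqP->|lt]; first by rewrite upd_eq.
  by rewrite upd_neq ?IP // neq_ltn lt.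
by rewrite eM => s1 _ [].
Qed.

Lemma sum_penalties_cost :
  choice_cost n m P E (fun=> 0%N) = \sum_(j < n) E j.
Proof.
rewrite /choice_cost /option_load [X in X + _](_ : _ = 0) ?add0r //.
by apply/le_anti/andP; split; [apply/bigmax_leP; split=> // i _; rewrite big_pred0 | exact: bigmax_ge_id].
Qed.

Lemma setup_spec s : ireg s 0 = n -> ireg s 1 = 1%N -> ireg s 5 = 0%N ->
  ireg s 8 = 0%N -> vreg s 0 = U -> vreg s 1 = 0 -> vreg s 3 = 0 ->
  varr s 0 = P -> varr s 1 = E -> iarr s 0 = (fun=> 0%N) ->
  post (constants m k ;; (sizes ;; options) ;; powers) s
    (fun s' => [/\ env n m k P E U s', sound n m P E U s' & ireg s' 6 = base n k]).
Proof.
move=> en e1 e5 e8 eU v1 v3 a0 a1 out.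
apply: post_then; do 5 next => /=.
set s1 := set_vreg _ 4 _.
apply: post_then; apply: post_then.
apply: post_use (@sizes_spec s1 en erefl e5) _ => s2 [agi2 aga2 agv2 agA2] [c2 b2].
apply: post_use (@options_spec s2 _ _ _ _ _ _ _ _) _; rewrite ?agi2 ?agv2 ?agA2 //.
move=> s3 [agi3 aga3 agv3 agA3] [q3 f3 t3 s3E].
apply: post_use (@powers_spec s3 _ _) _.
- by rewrite agi3 //= agi2.
- by rewrite agi3.
move=> s4 [agi4 aga4 agv4 agA4] [T4 p4].
split; last by rewrite agi4 //= agi3.
  split; [by rewrite agi4 //= agi3 //= agi2 | by rewrite agi4 //= agi3 //= agi2 |
          by rewrite agi4 //= agi3 //= agi2 | by rewrite agi4 //= agi3 | ].
  split; [by [] | by rewrite agi4 | by rewrite agv4 //= agv3 //= agv2 |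
          by rewrite agv4 //= agv3 //= agv2 | ].
  split; [by rewrite agv4 //= agv3 //= agv2 //= eU | by rewrite agA4 | by rewrite agA4 | by [] |
          by rewrite agi4 //= agi3 //= agi2].
rewrite /sound aga4 //= aga3 //= aga2 //= out; split=> //.
  by rewrite big1.
by rewrite agv4 // s3E sum_penalties_cost.
Qed.

End Setup.

(** * Running time and solutions *)

(** Used for the computability of the time bound as a function of [k], which is in register 0; the
    result is left in register 2. *)
Fixpoint monomial (C D : nat) : cmd :=
  if D is D'.+1 then
    monomial C D' ;; IConst 3 0 ;; For 4 0 (IAdd 3 3 2) ;; IMove 2 3
  else IConst 2 C.

Lemma monomial_spec (R : realFieldType) C D (s : state R) :
  post (monomial C D) s (fun s' =>
    ireg s' 2 = (C * ireg s 0 ^ D)%N /\ ireg s' 0 = ireg s 0).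
Proof.
elim: D => [|D IH] /=; first by next; rewrite /= muln1.
apply: post_then; apply: post_use IH _ => s1 _ [e2 e0]; next => /=.
seq_for (fun i (s' : state R) => ireg s' 3 = (i * (C * ireg s 0 ^ D))%N) => /=.
  by move=> i s2 _ [agi _ _ _] _ IH; next; rewrite /= IH agi //= e2 mulSnr.
rewrite e0 => s2 [agi _ _ _] e3; next => /=.
by rewrite e3 expnS mulnCA agi.
Qed.

Lemma monomial_exec (R : realFieldType) C D (s : state R) : ireg s 1 = 1%N ->
  exists t, exec (compile (monomial C D)) s t (run (monomial C D) s).
Proof.
have B x : x \in loop_bounds (monomial C D) -> x = (0, 0)%N.
  by elim: D => //= D IH; rewrite mem_cat => /orP[/IH//|]; rewrite !inE => /eqP.
move=> e1; have [|||t e _] := @exec_run R (ireg s 0).+1 (monomial C D) s _ isT e1.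
- by elim: (D) => //= D' ->.
- have W x : x \in writes (monomial C D) -> x \in [:: (0, 2); (0, 3); (0, 4)]%N.
    elim: (D) => [|D' IH] /=; first by rewrite inE => /eqP->.
    rewrite mem_cat => /orP[/IH//|].
    by rewrite !inE => /or4P[] /eqP->.
  by apply/allP => y /B->; apply/negP => /W.
- by move=> y /B[->].
- by exists t.
Qed.

Lemma computable_monomial C D : computable (fun k => C * k ^ D)%N.
Proof.
exists (Seq (Instr (IConst 1 1)) (Seq (compile (monomial C D)) (Instr (IMove 0 2)))).
move=> k; set s := State _ _ _ _.
have [t e] := @monomial_exec rat C D (exec_instr (IConst 1 1) s) erefl.
eexists _, _; split.
  by apply: ExecSeq (ExecInstr _ _) (ExecSeq e (ExecInstr _ _)).
by have [/= -> _] := post_run (monomial_spec C D (exec_instr (IConst 1 1) s)).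
Qed.

(** * Choices as solutions of an instance *)

Section Solutions.
Variables (R : realFieldType) (n m : nat) (I : instance R n).

Definition ptimes (j : nat) : R := oapp (ptime I) 0 (insub j).
Definition penalties (j : nat) : R := oapp (penalty I) 0 (insub j).

Lemma ptimes_ord (j : 'I_n) : ptimes j = ptime I j.
Proof. by rewrite /ptimes valK. Qed.

Lemma penalties_ord (j : 'I_n) : penalties j = penalty I j.
Proof. by rewrite /penalties valK. Qed.

Lemma ptimes_ge0 j : 0 <= ptimes j.
Proof. by rewrite /ptimes; case: insub => //= i; apply: ptime_ge0. Qed.

Lemma penalties_ge0 j : 0 <= penalties j.
Proof. by rewrite /penalties; case: insub => //= i; apply: penalty_ge0. Qed.

Definition choice_of (sol : solution n m) (j : nat) : nat :=
  oapp (fun i => oapp (fun o : 'I_m => o.+1) 0%N (sol i)) 0%N (insub j).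

Lemma choice_of_ord sol (j : 'I_n) :
  choice_of sol j = oapp (fun o : 'I_m => o.+1) 0%N (sol j).
Proof. by rewrite /choice_of valK. Qed.

Lemma choice_of_le sol j : (choice_of sol j <= m)%N.
Proof.
rewrite /choice_of; case: insub => //= i.
by case: (sol i) => //= o; apply: ltn_ord.
Qed.

Lemma cost_choice_of sol :
  cost I sol = choice_cost n m ptimes penalties (choice_of sol).
Proof.
rewrite /cost /makespan /choice_cost; congr (_ + _).
  apply: eq_bigr => i _; apply: eq_big => j; rewrite ?choice_of_ord.
    by case: (sol j) => [o|] //=; rewrite eqSS.
  by move=> _; rewrite /value /= ptimes_ord.
apply: eq_big => j; rewrite ?inE ?choice_of_ord; first by case: (sol j).
by move=> _; rewrite /value /= penalties_ord.
Qed.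

Lemma feasible_choice_of sol :
  feasible I sol = (\sum_(j < n) time_of ptimes j (choice_of sol j) <= bound I).
Proof.
rewrite /feasible big_mkcond /=; congr (_ <= _); apply: eq_bigr => j _.
by rewrite inE choice_of_ord /time_of; case: (sol j) => [o|] //=; rewrite ptimes_ord.
Qed.

Definition solution_of (c : nat -> nat) : solution n m :=
  [ffun j : 'I_n => if c j is i.+1 then insub i else None].

Lemma solution_ofK c : (forall j, (j < n)%N -> (c j <= m)%N) ->
  forall j : 'I_n, choice_of (solution_of c) j = c j.
Proof.
move=> cm j; rewrite choice_of_ord ffunE; have := cm j (ltn_ord j).
by case: (c j) => [|i] //= im; rewrite insubT.
Qed.

End Solutions.

(** * Running time and approximation guarantee *)

Definition steps : nat :=
  (1 + (weight (constants 0 0) + weight (sizes ;; options) + weight powers +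
        weight search))%N.

(** A common bound for all loop counts. The factor 2 absorbs the 1 added in [base], the exponent
    [m.+1] comes from [ncodes], and [maxn n 1] keeps the bound positive when there are no jobs. *)
Lemma bounds_le (n m k : nat) : (0 < k)%N ->
  let L := ((2 * m.+1 * k * maxn n 1 ^ 2) ^ m.+1)%N in
  [/\ (0 < L)%N, (n * m.+1 <= L)%N, (cap n k <= L)%N, (base n k <= L)%N & (ncodes n m k <= L)%N]
  /\ (n <= L)%N /\ (m.+1 <= L)%N.
Proof.
move=> k0; set N := maxn n 1; set X := (2 * m.+1 * k * N ^ 2)%N => /=.
have nN : (n <= N)%N by rewrite leq_maxl.
have N0 : (0 < N)%N by rewrite leq_maxr.
have X0 : (0 < X)%N by rewrite !muln_gt0 k0 N0.
have XL : (X <= X ^ m.+1)%N by rewrite expnS leq_pmulr // expn_gt0 X0.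
have mk : (m.+1 <= m.+1 * k)%N by rewrite leq_pmulr.
have kk : (k <= m.+1 * k)%N by rewrite leq_pmull.
have NN : (N <= N * N)%N by rewrite leq_pmulr.
have bX : (base n k <= X)%N.
  rewrite /base /cap /X -mulnn.
  have : (n * (n * k) <= k * (N * N))%N by rewrite mulnA mulnC leq_mul2l leq_mul ?orbT.
  have : (0 < k * (N * N))%N by rewrite !muln_gt0 k0 N0.
  have : (k * (N * N) <= m.+1 * k * (N * N))%N by rewrite leq_mul2r kk orbT.
  lia.
have mX : (m.+1 * N <= X)%N.
  rewrite /X -mulnn.
  have : (m.+1 * N <= m.+1 * k * (N * N))%N by rewrite leq_mul.
  lia.
have nmX : (n * m.+1 <= X)%N.
  by apply: leq_trans mX; rewrite mulnC leq_mul2l nN orbT.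
have cX : (cap n k <= X)%N.
  apply: leq_trans bX; rewrite /base /cap; case: (n) => // n'.
  by rewrite ltnW // ltnS leq_pmull.
split; first split.
- by rewrite expn_gt0 X0.
- exact: leq_trans XL.
- exact: leq_trans XL.
- exact: leq_trans XL.
- by rewrite /ncodes leq_exp2r.
split; apply: leq_trans XL; apply: leq_trans mX.
  by apply: leq_trans nN _; rewrite leq_pmull.
by rewrite leq_pmulr.
Qed.

Definition scheme (m k : nat) : cmd :=
  constants m k ;; ((sizes ;; options) ;; powers) ;; search.

(** An optimal solution is covered by the guess equal to the largest value it uses. That value is at
    most its cost, so the error is at most [opt_cost m I / k]. *)
Lemma search_approx (R : realFieldType) (n m k : nat) (I : instance R n)
    (s : state R) : (0 < m)%N -> (0 < k)%N ->
  sound n m (ptimes I) (penalties I) (bound I) s ->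
  (forall j o, (j < n)%N -> (o <= m)%N ->
     covers n m k (ptimes I) (penalties I) (bound I) s
       (value (ptimes I) (penalties I) j o)) ->
  let sol := solution_of n m (iarr s 0) in
  [/\ outputs s sol, feasible I sol &
      cost I sol <= (1 + k%:R^-1) * opt_cost m I].
Proof.
move=> m0 k0 [cm cU cE] cov sol.
have solE j : (j < n)%N -> choice_of sol j = iarr s 0 j.
  by move=> jn; apply: (solution_ofK cm (Ordinal jn)).
have costE : cost I sol = vreg s 1.
  by rewrite cost_choice_of cE; apply: eq_choice_cost.
split.
- by move=> j; rewrite -choice_of_ord solE.
- rewrite feasible_choice_of; under eq_bigr => j _ do rewrite solE //.
  by [].
have k0R : 0 < k%:R :> R by rewrite ltr0n.
have [[opt fopt ->] _] := opt_costP m I.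
have P0 := ptimes_ge0 I; have E0 := penalties_ge0 I.
have opt_load o : (o <= m)%N ->
    option_load n (ptimes I) (penalties I) (choice_of opt) o <= cost I opt.
  by move=> om; rewrite cost_choice_of; apply: option_load_le_cost.
suff : k%:R * cost I sol <= k%:R * cost I opt + cost I opt.
  move=> le; rewrite -(ler_pM2l k0R); apply: le_trans le _.
  by rewrite le_eqVlt; apply/orP; left; apply/eqP; field; rewrite gt_eqF.
have [n0|n0] := posnP n.
  have -> : sol = opt by apply/ffunP => j; have := ltn_ord j; rewrite {2}n0.
  rewrite lerDl; apply: le_trans (opt_load 0%N (leq0n _)); exact: option_load_ge0.
pose w (j : 'I_n) := value (ptimes I) (penalties I) j (choice_of opt j).
have [g _ gmax] := @arg_maxP _ R 'I_n (Ordinal n0) xpredT w isT.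
rewrite costE.
apply: (@le_trans _ _ (k%:R * cost I opt + w g)).
  rewrite cost_choice_of; apply: cov => //; first exact: choice_of_le.
  - by move=> j _; apply: choice_of_le.
  - by rewrite -feasible_choice_of.
  - by move=> j jn; apply: (gmax (Ordinal jn)).
rewrite lerD2l; apply: le_trans (opt_load _ (choice_of_le opt g)).
rewrite /option_load (bigD1 g) //= lerDl; apply: sumr_ge0 => j _.
exact: value_ge0.
Qed.

Theorem theorem2 (m : nat) (m_gt0 : (0 < m)%N) :
  exists (f : nat -> nat) (d : nat), computable f /\
    forall (eps : rat) (k : nat), 0 < eps < 1 -> eps^-1 = k%:R ->
    exists c : program,
      forall (R : realFieldType) (n : nat) (I : instance R n),
      exists (t : nat) (s : state R) (sol : solution n m),
        [/\ exec c (init_state I) t s,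
            outputs s sol,
            feasible I sol,
            cost I sol <= (1 + ratr eps) * opt_cost m I &
            (t <= f k * maxn n 1 ^ d)%N].
Proof.
(* The search nests 4 loops and [L] is a power with exponent [m.+1], hence [D]. As the base of this
   power contains the square of [maxn n 1], the degree in the number of jobs is [2 * D]. *)
pose D := (m.+1 * 4)%N; pose X := (2 * m.+1)%N.
exists (fun k => (steps * X ^ D) * k ^ D)%N, (2 * D)%N.
split; first exact: computable_monomial.
move=> eps k /andP[eps0 _] epsk.
have k0 : (0 < k)%N by rewrite -(ltr0n rat) -epsk invr_gt0.
have -> : eps = k%:R^-1 by rewrite -epsk invrK.
(* The first instruction puts 1 into register 1, as compiled loops require. *)
exists (Seq (Instr (IConst 1 1)) (compile (scheme m k))) => R n I.
have -> : ratr k%:R^-1 = k%:R^-1 :> R by rewrite fmorphV /= ratr_nat.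
pose s0 := exec_instr (IConst 1 1) (init_state I).
have P0 := ptimes_ge0 I; have E0 := penalties_ge0 I.
pose s1 := run (constants m k) s0.
have setup := post_run (@setup_spec R n m k (ptimes I) (penalties I) (bound I)
  (bound_ge0 I) s0 erefl erefl erefl erefl erefl erefl erefl erefl erefl erefl).
pose s2 := run (sizes ;; options) s1.
pose s3 := run powers s2.
have [env3 sound3 e6] : [/\ env n m k (ptimes I) (penalties I) (bound I) s3,
  sound n m (ptimes I) (penalties I) (bound I) s3 & ireg s3 6 = base n k] := setup.
have [sound4 cov4] := post_run (search_spec P0 E0 m_gt0 env3 sound3).
pose s4 := run search s3.
have [out feas cst] := search_approx m_gt0 k0 sound4 cov4.
pose L := ((X * k * maxn n 1 ^ 2) ^ m.+1)%N.
have [[L0 LQ Lcap LB LT] [Ln LM]] := bounds_le n m k0.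
have Lm : (m <= L)%N := ltnW LM.
have one2 : ireg s2 1 = 1%N by rewrite run_ireg.
have one3 : ireg s3 1 = 1%N by rewrite run_ireg.
have [t1 x1 l1] : exists2 t, exec (compile (constants m k)) s0 t s1 &
    (t <= weight (constants m k) * L ^ 0)%N by apply: exec_run.
have [t2 x2 l2] : exists2 t, exec (compile (sizes ;; options)) s1 t s2 &
    (t <= weight (sizes ;; options) * L ^ 2)%N.
  apply: exec_run => //.
  by move=> y; rewrite !inE => /or4P[] /eqP[->].
have [t3 x3 l3] : exists2 t, exec (compile powers) s2 t s3 &
    (t <= weight powers * L ^ 2)%N.
  apply: exec_run => //.
  (* The loop bounds of [powers] are not written by it, so their values can be read off its final
     state [s3]. *)
  move=> y yb; have : ireg s3 y = ireg s2 y.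
    by apply: run_ireg; move: yb; rewrite !inE => /orP[] /eqP[->].
  move: env3 => [_ _ e4 _ _] <-; move: yb; rewrite !inE => /orP[] /eqP[->].
    by rewrite e4.
  by rewrite e6.
have [t4 x4 l4] : exists2 t, exec (compile search) s3 t s4 &
    (t <= weight search * L ^ 4)%N.
  apply: exec_run => //.
  case: env3 => en em eM ecap [eT eQ _ _ _] y yb.
  have /allP/(_ _ yb) : all [in [:: (0, 0); (0, 3); (0, 4); (0, 5); (0, 7); (0, 8)]%N]
    (loop_bounds search) by [].
  rewrite !inE => /or4P[/eqP[->]|/eqP[->]|/eqP[->]|/or3P[] /eqP[->]];
    by rewrite ?en ?em ?eM ?ecap ?eT ?eQ.
exists (1 + (t1 + (t2 + t3 + t4)))%N, s4, (solution_of n m (iarr s4 0)).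
split=> //.
  apply: ExecSeq (ExecInstr _ _) _; apply: ExecSeq x1 _.
  exact: ExecSeq (ExecSeq x2 x3) x4.
have L4 : (L ^ 4 = X ^ D * k ^ D * maxn n 1 ^ (2 * D))%N.
  by rewrite /L -expnM 2!expnMn -expnM.
rewrite -(mulnA steps) -(mulnA steps) -L4 /steps.
have a0 : (0 < L ^ 4)%N by rewrite expn_gt0 L0.
have a1 : (L ^ 0 <= L ^ 4)%N by rewrite leq_pexp2l.
have a2 : (L ^ 2 <= L ^ 4)%N by rewrite leq_pexp2l.
have wc : weight (constants m k) = weight (constants 0 0) by [].
rewrite wc in l1.
move: (weight _) (weight _) (weight _) (weight _) l1 l2 l3 l4 => w1 w2 w3 w4 l1 l2 l3 l4.
rewrite !mulnDl mul1n.
apply: leq_add => //; rewrite addnA addnA; apply: leq_add; first apply: leq_add; first apply: leq_add.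
- by apply: leq_trans l1 _; rewrite leq_mul2l a1 orbT.
- by apply: leq_trans l2 _; rewrite leq_mul2l a2 orbT.
- by apply: leq_trans l3 _; rewrite leq_mul2l a2 orbT.
- by [].
Qed.
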